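(* Let $(X_1,0)$ and $(X_2,0)$ be germs of toric singularities of dimension $1$ (toric curves) defined by numerical semigroups $\Gamma_1,\Gamma_2\subset\mathbb{N}$, and let $(X,0)=(X_1\times X_2,0)$ be the germ of surface singularity defined by their product. Then the Lipschitz saturation $(X^s,0)$ is a toric surface singularity with semigroup $$\Gamma^s=\Gamma_1^s\times\Gamma_2^s\subset\mathbb{N}^2,$$ where $\Gamma_1^s$ and $\Gamma_2^s$ are the semigroups of the Lipschitz saturated curves $(X_1^s,0)$ and $(X_2^s,0)$.
   Context: **Toric singularities.** Let $\Gamma\subset\mathbb{Z}^d$ be a finitely generated semigroup (containing $0$) with generators $\gamma_1,\dots,\gamma_n$, generating $\mathbb{Z}^d$ as a group and such that the cone $\mathbb{R}_{\ge 0}\Gamma$ is strongly convex. Let $X_\Gamma\subset\mathbb{C}^n$ be the affine toric variety defined by the kernel of $\mathbb{C}[z_1,\dots,z_n]\to\mathbb{C}[t_1^{\pm1},\dots,t_d^{\pm1}]$, $z_i\mapsto t^{\gamma_i}$. $\mathbb{C}\{\Gamma\}$ denotes the ring of power series with exponents in $\Gamma$ that converge in a neighborhood of $0\in X_\Gamma$ (equivalently, the image of $\mathbb{C}\{z_1,\dots,z_n\}$ under $z_i\mapsto t^{\gamma_i}$); one has $\mathcal{O}_{X_\Gamma,0}\cong\mathbb{C}\{\Gamma\}$. A germ $(X,0)$ is a germ of toric singularity with (associated) semigroup $\Gamma$ if $\mathcal{O}_{X,0}\cong\mathbb{C}\{\Gamma\}$, equivalently $(X,0)\cong(X_\Gamma,0)$.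 Here $\mathbb{N}=\{0,1,2,\dots\}$. If $\Gamma_1$ has minimal generators $\gamma_1,\dots,\gamma_m$ and $\Gamma_2$ has minimal generators $\omega_1,\dots,\omega_n$, then $(X,0)=(X_1\times X_2,0)$ is a toric surface with semigroup $\Gamma=\Gamma_1\times\Gamma_2$ and normalization $(\mathbb{C}^2,0)\to(X,0)\subset(\mathbb{C}^{m+n},0)$, $(u,v)\mapsto(u^{\gamma_1},\dots,u^{\gamma_m},v^{\omega_1},\dots,v^{\omega_n})$, so $\overline{\mathcal{O}_{X,0}}=\mathbb{C}\{u,v\}$; similarly $\overline{\mathcal{O}_{X_1,0}}=\mathbb{C}\{u\}$ and $\overline{\mathcal{O}_{X_2,0}}=\mathbb{C}\{v\}$. **Lipschitz saturation.** Let $(X,0)$ be a reduced irreducible germ of complex analytic space. Let $\overline{\mathcal{O}_{X,0}}$ be the integral closure of $\mathcal{O}_{X,0}$ in its field of fractions; it is the analytic algebra of the normalization $n:(\overline{X},0)\to(X,0)$. Let $I_\Delta$ be the kernel of the natural surjection $\mathcal{O}_{\overline{X}\times\overline{X},(0,0)}\to\mathcal{O}_{\overline{X}\times_X\overline{X},(0,0)}$. (If $(X,0)\subset(\mathbb{C}^k,0)$ and $n=(\eta_1,\dots,\eta_k)$, then $I_\Delta$ is generated by $\eta_i(x)-\eta_i(y)$, $i=1,\dots,k$.) For an ideal $I$, $\overline{I}$ denotes its integral closure. The Lipschitz saturation of $\mathcal{O}_{X,0}$ is $$\mathcal{O}_{X,0}^s=\{f\in\overline{\mathcal{O}_{X,0}}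 : f(x)-f(y)\in\overline{I_\Delta}\}.$$ It is an analytic algebra with $\mathcal{O}_{X,0}\subset\mathcal{O}_{X,0}^s\subset\overline{\mathcal{O}_{X,0}}$, and the Lipschitz saturation $(X^s,0)$ is the germ of analytic space with algebra $\mathcal{O}_{X,0}^s$. **Semigroups of saturations.** $\Gamma_1^s=\{a\in\mathbb{N}: u^a\in\mathcal{O}_{X_1,0}^s\}$, $\Gamma_2^s=\{b\in\mathbb{N}: v^b\in\mathcal{O}_{X_2,0}^s\}$, and $\Gamma^s=\{(a,b)\in\mathbb{N}^2: u^av^b\in\mathcal{O}_{X,0}^s\}$. It is known that the Lipschitz saturation of a toric curve is again a toric curve, with $\mathcal{O}_{X_i,0}^s=\mathbb{C}\{\Gamma_i^s\}$. *)

(* Defs.v *)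
From HB Require Import structures.
From mathcomp Require Import all_boot all_order all_algebra.
From mathcomp Require Import boolp classical_sets reals.
From mathcomp Require Import complex mpoly.

Set Implicit Arguments.
Unset Strict Implicit.
Unset Printing Implicit Defensive.

Import Order.TTheory GRing.Theory Num.Theory.

Local Open Scope classical_set_scope.
Local Open Scope ring_scope.

(** * Formal power series K[[x_0, ..., x_(n-1)]] *)

Record fps (K : Type) (n : nat) := FPS { fcoef : 'X_{1..n} -> K }.

HB.instance Definition _ (K : choiceType) n := gen_eqMixin (fps K n).
HB.instance Definition _ (K : choiceType) n := gen_choiceMixin (fps K n).

Lemma fpsP (K : Type) n (f g : fps K n) : fcoef f =1 fcoef g -> f = g.
Proof. by case: f g => [f] [g] /= /funext ->. Qed.

Section FPSZmodule.
Variables (K : zmodType) (n : nat).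
Implicit Types f g : fps K n.

Definition fps0 : fps K n := FPS (fun=> 0).
Definition fps_opp f := FPS (fun m => - fcoef f m).
Definition fps_add f g := FPS (fun m => fcoef f m + fcoef g m).

Lemma fps_addA : associative fps_add.
Proof. by move=> f g h; apply: fpsP => m /=; rewrite addrA. Qed.
Lemma fps_addC : commutative fps_add.
Proof. by move=> f g; apply: fpsP => m /=; rewrite addrC. Qed.
Lemma fps_add0 : left_id fps0 fps_add.
Proof. by move=> f; apply: fpsP => m /=; rewrite add0r. Qed.
Lemma fps_addN : left_inverse fps0 fps_opp fps_add.
Proof. by move=> f; apply: fpsP => m /=; rewrite addNr. Qed.

HB.instance Definition _ := GRing.isZmodule.Build (fps K n)
  fps_addA fps_addC fps_add0 fps_addN.
End FPSZmodule.

Section FPSRing.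
Variables (K : comNzRingType) (n : nat).
Implicit Types f g h : fps K n.

Definition fpsX (m0 : 'X_{1..n}) : fps K n := FPS (fun m => (m == m0)%:R).

Definition fps_mul f g := FPS (fun m : 'X_{1..n} =>
  \sum_(k : 'X_{1..n < (mdeg m).+1, (mdeg m).+1} | m == (k.1 + k.2)%MM)
    fcoef f k.1 * fcoef g k.2).

Definition fps_trunc (N : nat) f : {mpoly K[n]} :=
  \sum_(k : 'X_{1..n < N}) fcoef f k *: 'X_[k].

Lemma fps_truncE N f m : (mdeg m < N)%N -> (fps_trunc N f)@_m = fcoef f m.
Proof.
move=> lt; rewrite raddf_sum /= (bigD1 (BMultinom lt)) //= mcoeffZ mcoeffX.
rewrite eqxx mulr1 big1 ?addr0 // => k /negPf; rewrite bmeqP /= => km.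
by rewrite mcoeffZ mcoeffX km mulr0.
Qed.

Lemma fps_mul_trunc N f g m : (mdeg m < N)%N ->
  fcoef (fps_mul f g) m = (fps_trunc N f * fps_trunc N g)@_m.
Proof.
move=> lt; rewrite /= mcoeffM; apply: eq_bigr => -[[k kP] [l lP]] _ /=.
by rewrite !fps_truncE // (leq_trans _ lt).
Qed.

Lemma fps_mul_bound N f g m : (mdeg m < N)%N ->
  fcoef (fps_mul f g) m =
  \sum_(k : 'X_{1..n < N, N} | m == (k.1 + k.2)%MM)
    fcoef f k.1 * fcoef g k.2.
Proof.
move=> lt; rewrite (fps_mul_trunc _ _ lt) (mcoeff_poly_mul _ _ lt).
by apply: eq_bigr => -[[k kP] [l lP]] _ /=; rewrite !fps_truncE.
Qed.

Lemma mcoeffM_eq N (p p' q q' : {mpoly K[n]}) m : (mdeg m < N)%N ->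
  (forall k, (mdeg k < N)%N -> p@_k = p'@_k) ->
  (forall k, (mdeg k < N)%N -> q@_k = q'@_k) -> (p * q)@_m = (p' * q')@_m.
Proof.
move=> lt pE qE; rewrite !(mcoeff_poly_mul _ _ lt).
by apply: eq_bigr => -[[k kP] [l lP]] _ /=; rewrite pE ?qE.
Qed.

Lemma fps_mulC : commutative fps_mul.
Proof.
by move=> f g; apply: fpsP => m; rewrite !(fps_mul_trunc _ _ (ltnSn _)) mulrC.
Qed.

Lemma fps_mulA : associative fps_mul.
Proof.
move=> f g h; apply: fpsP => m; set N := (mdeg m).+1.
have lt : (mdeg m < N)%N by [].
have E f' g' k : (mdeg k < N)%N ->
    (fps_trunc N (fps_mul f' g'))@_k = (fps_trunc N f' * fps_trunc N g')@_k.
  by move=> kN; rewrite fps_truncE // (fps_mul_trunc _ _ kN).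
rewrite !(fps_mul_trunc _ _ lt).
rewrite (mcoeffM_eq lt (fun _ _ => erefl _) (E g h)).
by rewrite (mcoeffM_eq lt (E f g) (fun _ _ => erefl _)) mulrA.
Qed.

Lemma fps_mul1 : left_id (fpsX 0%MM) fps_mul.
Proof.
move=> f; apply: fpsP => m; set N := (mdeg m).+1.
have lt : (mdeg m < N)%N by [].
have E k : (mdeg k < N)%N -> (fps_trunc N (fpsX 0%MM))@_k = (1 : {mpoly K[n]})@_k.
  by move=> kN; rewrite fps_truncE //= mcoeff1.
rewrite (fps_mul_trunc _ _ lt) (mcoeffM_eq lt E (fun _ _ => erefl _)).
by rewrite mul1r fps_truncE.
Qed.

Lemma fps_mulDl : left_distributive fps_mul (@fps_add K n).
Proof.
move=> f g h; apply: fpsP => m /=; rewrite -big_split /=.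
by apply: eq_bigr => k _; rewrite mulrDl.
Qed.

Lemma fps_oner_neq0 : fpsX 0%MM != 0.
Proof.
apply/eqP => /(congr1 (fun f => fcoef f 0%MM)) /eqP /=.
by rewrite eqxx oner_eq0.
Qed.

HB.instance Definition _ := GRing.Zmodule_isComNzRing.Build (fps K n)
  fps_mulA fps_mulC fps_mul1 fps_mulDl fps_oner_neq0.

Definition fps_scale (c : K) f := FPS (fun m => c * fcoef f m).

Lemma fps_scaleA c d f : fps_scale c (fps_scale d f) = fps_scale (c * d) f.
Proof. by apply: fpsP => m /=; rewrite mulrA. Qed.
Lemma fps_scale1 : left_id 1 fps_scale.
Proof. by move=> f; apply: fpsP => m /=; rewrite mul1r. Qed.
Lemma fps_scaleDr : right_distributive fps_scale +%R.
Proof. by move=> c f g; apply: fpsP => m /=; rewrite mulrDr. Qed.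
Lemma fps_scaleDl f : {morph fps_scale^~ f : c d / c + d}.
Proof. by move=> c d; apply: fpsP => m /=; rewrite mulrDl. Qed.

HB.instance Definition _ := GRing.Zmodule_isLmodule.Build K (fps K n)
  fps_scaleA fps_scale1 fps_scaleDr fps_scaleDl.

Lemma fps_scaleAl (c : K) f g : c *: (f * g) = (c *: f) * g.
Proof.
apply: fpsP => m /=; rewrite big_distrr /=.
by apply: eq_bigr => k _; rewrite mulrA.
Qed.
HB.instance Definition _ := GRing.Lmodule_isLalgebra.Build K (fps K n) fps_scaleAl.
HB.instance Definition _ := GRing.Lalgebra_isComAlgebra.Build K (fps K n).

End FPSRing.

(** * Convergent power series *)

Section Convergence.
Variables (K : numFieldType) (n : nat).
Implicit Types f g : fps K n.

(* Absolute convergence at the point (r, ..., r), i.e. on a polydisc.  When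
   K = R[i], an inequality 0 < r or _ <= M forces r and M to be real. *)
Definition convergent f := exists r M : K, 0 < r /\
  forall N : nat, \sum_(m : 'X_{1..n < N}) `|fcoef f m| * r ^+ mdeg m <= M.

Lemma convergent_shrink f r M s : 0 < s -> s <= r ->
  (forall N, \sum_(m : 'X_{1..n < N}) `|fcoef f m| * r ^+ mdeg m <= M) ->
  forall N, \sum_(m : 'X_{1..n < N}) `|fcoef f m| * s ^+ mdeg m <= M.
Proof.
move=> s0 sr fM N; apply: le_trans (fM N); apply: ler_sum => m _.
by rewrite ler_wpM2l // lerXn2r // nnegrE ltW // (lt_le_trans s0).
Qed.

Lemma convergent2 f g : convergent f -> convergent g ->
  exists r Mf Mg : K, [/\ 0 < r,
    forall N, \sum_(m : 'X_{1..n < N}) `|fcoef f m| * r ^+ mdeg m <= Mf &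
    forall N, \sum_(m : 'X_{1..n < N}) `|fcoef g m| * r ^+ mdeg m <= Mg].
Proof.
move=> [r1 [M1 [r10 H1]]] [r2 [M2 [r20 H2]]].
have [le12|le21] := real_leP (gtr0_real r10) (gtr0_real r20).
  by exists r1, M1, M2; split=> //; exact: convergent_shrink H2.
by exists r2, M1, M2; split=> //; apply: convergent_shrink H1 => //; exact: ltW.
Qed.

Definition convergentb : {pred fps K n} := [pred f | `[< convergent f >]].

Lemma convergentP f : reflect (convergent f) (f \in convergentb).
Proof. exact: asboolP. Qed.

Lemma convergent0 : convergent 0.
Proof.
exists 1, 0; split=> // N; rewrite big1 // => m _ /=.
by rewrite normr0 mul0r.
Qed.

Lemma convergentX m0 : convergent (fpsX K m0).
Proof.
exists 1, 1; split=> // N.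
have [lt|ge] := ltnP (mdeg m0) N.
  rewrite (bigD1 (BMultinom lt)) //= eqxx normr1 expr1n mulr1 big1 ?addr0 //.
  by move=> m /negPf; rewrite bmeqP /= => ->; rewrite normr0 mul0r.
rewrite big1 // => m _ /=; case: eqP => [E|_]; last by rewrite normr0 mul0r.
by have := bmdeg m; rewrite E ltnNge ge.
Qed.

Lemma convergentD f g : convergent f -> convergent g -> convergent (f + g).
Proof.
move=> cf cg; have [r [Mf [Mg [r0 Hf Hg]]]] := convergent2 cf cg.
exists r, (Mf + Mg); split=> // N.
apply: le_trans (lerD (Hf N) (Hg N)); rewrite -big_split /=.
apply: ler_sum => m _; rewrite -mulrDl ler_wpM2r ?ler_normD //.
by rewrite exprn_ge0 // ltW.
Qed.

Lemma convergentZ (c : K) f : convergent f -> convergent (c *: f).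
Proof.
move=> [r [M [r0 Hf]]]; exists r, (`|c| * M); split=> // N.
apply: le_trans (ler_wpM2l (normr_ge0 c) (Hf N)); rewrite mulr_sumr.
by apply: ler_sum => m _ /=; rewrite normrM mulrA.
Qed.

Lemma convergentN f : convergent f -> convergent (- f).
Proof. by rewrite -scaleN1r; exact: convergentZ. Qed.

Lemma convergentM f g : convergent f -> convergent g -> convergent (f * g).
Proof.
move=> cf cg; have [r [Mf [Mg [r0 Hf Hg]]]] := convergent2 cf cg.
have rX_ge0 k : 0 <= r ^+ k by rewrite exprn_ge0 // ltW.
have S_ge0 (h : fps K n) N :
    0 <= \sum_(m : 'X_{1..n < N}) `|fcoef h m| * r ^+ mdeg m.
  by apply: sumr_ge0 => m _; rewrite mulr_ge0.
exists r, (Mf * Mg); split=> // N.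
pose F (k : 'X_{1..n < N, N}) :=
  (`|fcoef f k.1| * r ^+ mdeg k.1) * (`|fcoef g k.2| * r ^+ mdeg k.2).
have F_ge0 k : 0 <= F k by rewrite !mulr_ge0.
apply: (@le_trans _ _ (\sum_k F k)); last first.
  apply: le_trans (ler_pM (S_ge0 f N) (S_ge0 g N) (Hf N) (Hg N)).
  rewrite mulr_suml -(pair_bigA _ (fun a b : 'X_{1..n < N} => F (a, b))) /=.
  by apply: ler_sum => a _; rewrite mulr_sumr.
apply: (@le_trans _ _ (\sum_(m : 'X_{1..n < N})
    \sum_(k : 'X_{1..n < N, N} | bmnm m == (k.1 + k.2)%MM) F k)).
  apply: ler_sum => m _; rewrite (fps_mul_bound _ _ (bmdeg m)).
  apply: (le_trans (ler_wpM2r (rX_ge0 _) (ler_norm_sum _ _ _))).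
  rewrite mulr_suml; apply: ler_sum => k /eqP ->.
  by rewrite normrM mdegD exprD /F mulrACA.
rewrite (exchange_big_dep xpredT) //=; apply: ler_sum => k _.
have [/existsP[m0 /eqP E]|/existsPn Nex] :=
  boolP [exists m : 'X_{1..n < N}, bmnm m == (k.1 + k.2)%MM].
  by rewrite (big_pred1 m0) // => m /=; rewrite -E bmeqP.
by rewrite big_pred0 // => m; apply/negbTE/Nex.
Qed.

Fact convergent_subalg_closed : GRing.subalg_closed convergentb.
Proof.
split=> [|c f g|f g].
- by apply/convergentP/convergentX.
- move=> /convergentP cf /convergentP cg; apply/convergentP.
  exact: convergentD (convergentZ _ cf) cg.
- by move=> /convergentP cf /convergentP cg; apply/convergentP/convergentM.
Qed.

HB.instance Definition _ := GRing.isSubringClosed.Build (fps K n) convergentb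
  (GRing.subalg_closedBM convergent_subalg_closed).
HB.instance Definition _ := GRing.isScaleClosed.Build K (fps K n) convergentb
  (GRing.subsemimod_closedZ
     (GRing.submod_closed_semi (GRing.subalg_closedZ convergent_subalg_closed))).

End Convergence.

(* The K-algebra K{x_0, ..., x_(n-1)}. *)
Record cps (K : numFieldType) (n : nat) :=
  CPS { cps_val :> fps K n; _ : cps_val \in @convergentb K n }.

Section CPSAlgebra.
Variables (K : numFieldType) (n : nat).
HB.instance Definition _ := [isSub for @cps_val K n].
HB.instance Definition _ := [Choice of cps K n by <:].
HB.instance Definition _ := [SubChoice_isSubComNzRing of cps K n by <:].
HB.instance Definition _ := [SubZmodule_isSubLmodule of cps K n by <:].
HB.instance Definition _ := [SubNzRing_SubLmodule_isSubLalgebra of cps K n by <:].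
HB.instance Definition _ := [SubLalgebra_isSubAlgebra of cps K n by <:].

Definition cpsX (m : 'X_{1..n}) : cps K n := CPS (introT (convergentP _) (convergentX K m)).
End CPSAlgebra.

(** * The two inclusions K{x} -> K{x, y} *)

Section Pullbacks.
Variables (K : numFieldType) (d : nat).
Implicit Types f : cps K d.

Definition mnm_left (m : 'X_{1..d + d}) := [multinom m (lshift d i) | i < d].
Definition mnm_right (m : 'X_{1..d + d}) := [multinom m (rshift d i) | i < d].

Definition mnm_pair (a b : 'X_{1..d}) : 'X_{1..d + d} :=
  [multinom match split i with inl j => a j | inr j => b j end | i < d + d].

Lemma mnm_pairK m : mnm_pair (mnm_left m) (mnm_right m) = m.
Proof.
apply/mnmP => i; rewrite mnmE; case: splitP => j ij; rewrite mnmE;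
  by congr (fun_of_multinom m _); apply: val_inj.
Qed.

Lemma mnm_pair_left a b : mnm_left (mnm_pair a b) = a.
Proof. by apply/mnmP => i; rewrite !mnmE (unsplitK (inl i)). Qed.

Lemma mnm_pair_right a b : mnm_right (mnm_pair a b) = b.
Proof. by apply/mnmP => i; rewrite !mnmE (unsplitK (inr i)). Qed.

Lemma mdeg_pair a b : mdeg (mnm_pair a b) = (mdeg a + mdeg b)%N.
Proof.
rewrite !mdegE big_split_ord /=; congr (_ + _)%N; apply: eq_bigr => i _.
  by rewrite mnmE (unsplitK (inl i)).
by rewrite mnmE (unsplitK (inr i)).
Qed.

(* f(x) *)
Definition fps_in_x (f : fps K d) : fps K (d + d) :=
  FPS (fun m => if mnm_right m == 0%MM then fcoef f (mnm_left m) else 0).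

(* f(y) *)
Definition fps_in_y (f : fps K d) : fps K (d + d) :=
  FPS (fun m => if mnm_left m == 0%MM then fcoef f (mnm_right m) else 0).

Lemma convergent_in_x f : fps_in_x f \in @convergentb K (d + d).
Proof.
apply/convergentP; have /convergentP[r [M [r0 H]]] := valP f.
exists r, M; split=> // N; apply: le_trans (H N).
have lt (k : 'X_{1..d < N}) : (mdeg (mnm_pair k 0%MM) < N)%N.
  by rewrite mdeg_pair mdeg0 addn0 bmdeg.
have ltl (m : bmultinom (d + d) N) : (mdeg (mnm_left m) < N)%N.
  by apply: leq_ltn_trans (bmdeg m); rewrite -[X in (_ <= mdeg X)%N]mnm_pairK mdeg_pair leq_addr.
rewrite (bigID (fun m : bmultinom (d + d) N => mnm_right m == 0%MM)) /= addrC.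
rewrite big1 ?add0r => [|m /negPf -> /=]; last by rewrite normr0 mul0r.
rewrite (reindex_onto (fun k => BMultinom (lt k)) (fun m => BMultinom (ltl m))) /=.
  rewrite [leRHS](bigID (fun k : 'X_{1..d < N} =>
    (mnm_right (mnm_pair k 0%MM) == 0%MM) && (BMultinom (ltl (BMultinom (lt k))) == k))) /=.
  rewrite -[leLHS]addr0 lerD ?sumr_ge0 // => [|k _]; last first.
    by rewrite mulr_ge0 // exprn_ge0 // ltW.
  apply: ler_sum => k _.
  by rewrite mnm_pair_right eqxx mnm_pair_left mdeg_pair mdeg0 addn0.
by move=> m /eqP m0; apply: val_inj; rewrite /= -[RHS]mnm_pairK m0.
Qed.

Lemma convergent_in_y f : fps_in_y f \in @convergentb K (d + d).
Proof.
apply/convergentP; have /convergentP[r [M [r0 H]]] := valP f.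
exists r, M; split=> // N; apply: le_trans (H N).
have lt (k : 'X_{1..d < N}) : (mdeg (mnm_pair 0%MM k) < N)%N.
  by rewrite mdeg_pair mdeg0 add0n bmdeg.
have ltr (m : bmultinom (d + d) N) : (mdeg (mnm_right m) < N)%N.
  by apply: leq_ltn_trans (bmdeg m); rewrite -[X in (_ <= mdeg X)%N]mnm_pairK mdeg_pair leq_addl.
rewrite (bigID (fun m : bmultinom (d + d) N => mnm_left m == 0%MM)) /= addrC.
rewrite big1 ?add0r => [|m /negPf -> /=]; last by rewrite normr0 mul0r.
rewrite (reindex_onto (fun k => BMultinom (lt k)) (fun m => BMultinom (ltr m))) /=.
  rewrite [leRHS](bigID (fun k : 'X_{1..d < N} =>
    (mnm_left (mnm_pair 0%MM k) == 0%MM) && (BMultinom (ltr (BMultinom (lt k))) == k))) /=.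
  rewrite -[leLHS]addr0 lerD ?sumr_ge0 // => [|k _]; last first.
    by rewrite mulr_ge0 // exprn_ge0 // ltW.
  apply: ler_sum => k _.
  by rewrite mnm_pair_left eqxx mnm_pair_right mdeg_pair mdeg0 add0n.
by move=> m /eqP m0; apply: val_inj; rewrite /= -[RHS]mnm_pairK m0.
Qed.

Definition in_x f : cps K (d + d) := CPS (convergent_in_x f).
Definition in_y f : cps K (d + d) := CPS (convergent_in_y f).

End Pullbacks.

(** * Ideals and integral closure *)

Section IntegralClosure.
Variable B : comNzRingType.
Implicit Types (S I A : set B) (f : B).

Definition ideal_gen S : set B := [set f |
  exists (n : nat) (c s : 'I_n -> B),
    (forall i, S (s i)) /\ f = \sum_(i < n) c i * s i].

Definition ideal_exp I (k : nat) : set B := ideal_gen [set f |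
  exists s : 'I_k -> B, (forall i, I (s i)) /\ f = \prod_(i < k) s i].

(* f ^ n + a_1 f ^ (n - 1) + ... + a_n = 0 with a_i in I ^ i *)
Definition ideal_closure I : set B := [set f |
  exists (n : nat) (a : nat -> B), [/\ (0 < n)%N,
    forall i, (1 <= i <= n)%N -> ideal_exp I i (a i) &
    f ^+ n + \sum_(1 <= i < n.+1) a i * f ^+ (n - i) = 0]].

(* The elements of B that lie in the field of fractions of the subring A and
   are integral over A; this is the integral closure of A in its field of
   fractions as soon as B is integrally closed and contains A. *)
Definition integral_closure A : set B := [set f |
  (exists p q : B, [/\ A p, A q, q != 0 & q * f = p]) /\
  (exists (n : nat) (a : nat -> B), [/\ (0 < n)%N,
    forall i, (1 <= i <= n)%N -> A (a i) &
    f ^+ n + \sum_(1 <= i < n.+1) a i * f ^+ (n - i) = 0])].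

End IntegralClosure.

(** * Lipschitz saturation *)

Section Saturation.
Variables (K : numFieldType) (d : nat).

(* A is the local ring of a germ (X, 0) with normalization (K^d, 0) -> (X, 0),
   regarded as a subring of K{x_1, ..., x_d}.  The fibre product of the
   normalization with itself over X is cut out in K^d x K^d by the equations
   h(x) = h(y) for h in A. *)
Definition diagonal_ideal (A : set (cps K d)) : set (cps K (d + d)) :=
  ideal_gen [set g | exists2 h, A h & g = in_x h - in_y h].

Definition lipschitz_saturation (A : set (cps K d)) : set (cps K d) :=
  [set f | integral_closure A f /\
           ideal_closure (diagonal_ideal A) (in_x f - in_y f)].

(* The exponents of the monomials in A. *)
Definition exponents (A : set (cps K d)) : set 'X_{1..d} :=
  [set m | A (cpsX K m)].

End Saturation.

(** * Toric singularities with semigroup in N^d *)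

(* The cone over S lies in the positive orthant, so it is strongly convex. *)
Definition toric_semigroup (d : nat) (S : set 'X_{1..d}) : Prop :=
  exists (n : nat) (g : 'I_n -> 'X_{1..d}),
    (forall m : 'X_{1..d}, S m <-> exists k : 'I_n -> nat,
       forall j, m j = (\sum_(i < n) k i * g i j)%N) /\
    (forall z : 'I_d -> int, exists c : 'I_n -> int,
       forall j, z j = \sum_(i < n) c i * (g i j)%:Z).

(* K{S}.  For generators g_1, ..., g_n of S in N^d, all nonzero, a series
   with exponents in S is the image of a convergent series in z_1, ..., z_n
   under z_i |-> t^(g_i) if and only if it converges near 0 in K^d. *)
Definition toric_algebra (K : numFieldType) (d : nat) (S : set 'X_{1..d}) :
    set (cps K d) :=
  [set f | forall m, fcoef f m != 0 -> S m].
Arguments toric_algebra K {d} S.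

Definition subalg_iso (K : nzRingType) (V W : algType K) (A : set V) (B : set W) : Prop :=
  exists phi : V -> W,
    [/\ [/\ forall f, A f -> B (phi f),
            forall f g, A f -> A g -> phi f = phi g -> f = g &
            forall h, B h -> exists2 f, A f & phi f = h],
        phi 1 = 1,
        forall f g, A f -> A g -> phi (f + g) = phi f + phi g,
        forall f g, A f -> A g -> phi (f * g) = phi f * phi g &
        forall (c : K) f, A f -> phi (c *: f) = c *: phi f].

(* The germ with local ring A is a toric singularity with semigroup S. *)
Definition toric_singularity (K : numFieldType) (d : nat)
    (A : set (cps K d)) (S : set 'X_{1..d}) : Prop :=
  toric_semigroup S /\ subalg_iso A (toric_algebra K S).

(** * Numerical semigroups *)

Definition numerical_semigroup (S : set nat) : Prop :=
  [/\ S 0%N, forall a b, S a -> S b -> S (a + b)%N &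
      exists c, forall n, (c <= n)%N -> S n].

Definition nat_exponents (S : set nat) : set 'X_{1..1} :=
  [set m | S (m ord0)].

Definition exponents_nat (S : set 'X_{1..1}) : set nat :=
  [set a | S [multinom a | _ < 1]].

Definition semigroup_prod (S1 S2 : set nat) : set 'X_{1..2} :=
  [set m | S1 (m ord0) /\ S2 (m ord_max)].

(* Main.v *)
From HB Require Import structures.
Require Import Defs.
From mathcomp Require Import all_boot all_order all_algebra all_solvable all_field.
From mathcomp Require Import boolp classical_sets reals.
From mathcomp Require Import complex mpoly.
From mathcomp Require Import ring zify.

(** For a numerical semigroup G, let G^s be the set of all a in N that are
    divisible by the gcd of the elements of G up to a; it is again a numerical
    semigroup.  The proof shows, for every d and all numerical semigroups
    G_1, ..., G_d, that the Lipschitz saturation of K{G_1 x ... x G_d} is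
    K{G_1^s x ... x G_d^s} ([lipschitz_saturation_toric]).  The cases d = 1 and
    d = 2 identify the three semigroups of the theorem, and the saturation,
    being the algebra of a product of numerical semigroups, is toric.
    Write O for K{G_1 x ... x G_d} and I for the ideal generated by the
    h(x) - h(y), h in O.

    Exponents of the saturation lie in the product of the G_i^s
    ([closure_exponents]).  Suppose that a monomial of f has i-th exponent a
    outside G_i^s.  Then there are n > 0 that divides every element of G_i up
    to a but not a, and w with w^n = 1 and w^a <> 1.  Substituting y_i = w x_i
    and y_j = x_j for j <> i sends h(x) - h(y) to the series with coefficients
    (1 - w^(m_i)) h_m; for h in O these vanish as soon as m_i <= a, so I is
    sent into the series of x_i-order > a.  Order is a valuation, hence the
    integral closure of I is sent there too, whereas the image of f(x) - f(y)
    has a nonzero coefficient at a monomial of x_i-order a.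

    Conversely, the differences x^a - y^a with a in G^s are integral over the
    x^g - y^g with g in G.  The relation
    x^(k+l) - y^(k+l) = x^l (x^k - y^k) + y^k (x^l - y^l) lets Euclid's
    algorithm run: up to multiplication by (x, y)^N, the exponents k for which
    x^k - y^k is a combination of the x^g - y^g, g <= a, are closed under sums
    and differences, so they contain the gcd of these g and its multiple a
    ([absorbed_gcd_saturation]).  Because g <= a, degrees allow coefficients in
    (x, y)^N, that is (x^a - y^a) J is contained in I J for J = (x, y)^N.  The
    product of such ideals J over all variables is a faithful module that
    witnesses integrality for all variables at once, through the determinant
    trick ([det_trick]).
    Cutting a series along the exponents below a common conductor writes it as
    a finite sum of x^e f_e with f_e in O ([slice_sum]), which reduces f(x) - f(y)
    to finitely many monomials ([diagonal_closure]).  The same decomposition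
    shows that K{x} is a finite O-module, so that its elements are integral over
    O; multiplication by a high monomial moves them into O, so that they are in
    the fraction field of O as well ([integral_closure_toric]). *)

Set Implicit Arguments.
Unset Strict Implicit.
Unset Printing Implicit Defensive.

Import Order.TTheory GRing.Theory Num.Theory.
Local Open Scope ring_scope.

(** * Ideals and their powers *)

Section IdealLemmas.
Variable B : comNzRingType.
Implicit Types (S I : set B) (f g c : B).

Lemma ideal_gen_ind S (P : B -> Prop) : P 0 ->
  (forall c s f, S s -> P f -> P (c * s + f)) ->
  forall f, ideal_gen S f -> P f.
Proof.
move=> P0 PS f [n [c [s [Ss ->]]]].
elim: n c s Ss => [|n IHn] c s Ss; first by rewrite big_ord0.
by rewrite big_ord_recl; apply: PS => //; apply: IHn.
Qed.

Lemma ideal_gen0 S : ideal_gen S 0.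
Proof. by exists 0%N, (fun=> 0), (fun=> 0); split=> [[]|]; rewrite ?big_ord0. Qed.

Lemma ideal_genMDl S c s f : S s -> ideal_gen S f -> ideal_gen S (c * s + f).
Proof.
move=> Ss [n [a [t [St ->]]]].
exists n.+1, (fun i => oapp a c (unlift ord0 i)), (fun i => oapp t s (unlift ord0 i)).
split=> [i|]; first by case: (unlift ord0 i).
rewrite big_ord_recl unlift_none /=; congr (_ + _).
by apply: eq_bigr => i _; rewrite liftK.
Qed.

Lemma ideal_gen_mem S s : S s -> ideal_gen S s.
Proof. by move=> Ss; rewrite -[s]addr0 -[s]mul1r; apply/ideal_genMDl/ideal_gen0. Qed.

Lemma ideal_genMl S c f : ideal_gen S f -> ideal_gen S (c * f).
Proof.
elim/ideal_gen_ind => [|a s g Ss Ig]; first by rewrite mulr0; apply: ideal_gen0.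
by rewrite mulrDr mulrA; apply: ideal_genMDl.
Qed.

Lemma ideal_genD S f g : ideal_gen S f -> ideal_gen S g -> ideal_gen S (f + g).
Proof.
move=> + Ig; elim/ideal_gen_ind => [|a s h Ss Ih]; first by rewrite add0r.
by rewrite -addrA; apply: ideal_genMDl.
Qed.

Lemma ideal_genB S f g : ideal_gen S f -> ideal_gen S g -> ideal_gen S (f - g).
Proof. by move=> If Ig; rewrite -mulN1r; apply/ideal_genD/ideal_genMl. Qed.

Lemma ideal_exp0 I f : ideal_exp I 0 f.
Proof.
rewrite -[f]mulr1; apply/ideal_genMl/ideal_gen_mem.
by exists (fun=> 0); split=> [[]|]; rewrite ?big_ord0.
Qed.

Lemma ideal_exp1 I f : I f -> ideal_exp I 1 f.
Proof.
by move=> If; apply: ideal_gen_mem; exists (fun=> f); rewrite big_ord1.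
Qed.

Lemma ideal_expM I i j f g :
  ideal_exp I i f -> ideal_exp I j g -> ideal_exp I (i + j) (f * g).
Proof.
move=> + Ig; elim/ideal_gen_ind => [|c s h]; first by rewrite mul0r; apply: ideal_gen0.
move=> [s_ [Is ->]] IH; rewrite mulrDl; apply: ideal_genD => //.
rewrite -mulrA; apply: ideal_genMl.
elim/ideal_gen_ind: Ig => [|d t k]; first by rewrite mulr0; apply: ideal_gen0.
move=> [t_ [It ->]] Ik; rewrite mulrDr; apply: ideal_genD => //.
rewrite mulrCA; apply/ideal_genMl/ideal_gen_mem.
exists (fun k => match split k with inl a => s_ a | inr b => t_ b end).
split=> [a|]; first by case: splitP.
rewrite big_split_ord /=; congr (_ * _); apply: eq_bigr => a _.
  by rewrite (unsplitK (inl a)).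
by rewrite (unsplitK (inr a)).
Qed.

End IdealLemmas.

(** * The determinant trick *)

Section DeterminantTrick.
Variable B : comNzRingType.

(** Both notions of integral dependence are instances: the constant filtration
    by a subring A gives integrality over A, and the powers of an ideal I give
    integrality over I. *)
Definition ring_filtration (P : nat -> set B) : Prop :=
  [/\ P 0%N 1, forall i, P i 0,
      forall i f g, P i f -> P i g -> P i (f - g) &
      forall i j f g, P i f -> P j g -> P (i + j)%N (f * g)].

(** The degree n part of the extended Rees algebra of P, where X has degree 1:
    the coefficient of X^j has filtration level n - j. *)
Definition rees (P : nat -> set B) (n : nat) (p : {poly B}) : Prop :=
  (forall j, (j <= n)%N -> P (n - j)%N p`_j) /\
  (forall j, (n < j)%N -> p`_j = 0).

Section Rees.
Variables (P : nat -> set B) (PP : ring_filtration P).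

Lemma filtrationN i f : P i f -> P i (- f).
Proof. by case: PP => _ P0 PB _ Pf; rewrite -sub0r; apply: PB. Qed.

Lemma filtrationD i f g : P i f -> P i g -> P i (f + g).
Proof.
by move=> Pf /filtrationN Pg; rewrite -[g]opprK; case: PP => _ _ PB _; apply: PB.
Qed.

Lemma reesD n p q : rees P n p -> rees P n q -> rees P n (p + q).
Proof.
move=> [p1 p2] [q1 q2]; split=> j jn; rewrite coefD; last by rewrite p2 ?q2 ?addr0.
by apply: filtrationD; auto.
Qed.

Lemma reesN n p : rees P n p -> rees P n (- p).
Proof.
move=> [p1 p2]; split=> j jn; rewrite coefN; last by rewrite p2 ?oppr0.
by apply: filtrationN; auto.
Qed.

Lemma rees0 n : rees P n 0.
Proof. by case: PP => _ P0 _ _; split=> j jn; rewrite coef0. Qed.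

Lemma rees1 : rees P 0 1.
Proof.
case: PP => P1 _ _ _; split=> j; rewrite coef1; last by case: j.
by rewrite leqn0 => /eqP ->.
Qed.

Lemma reesM m n p q : rees P m p -> rees P n q -> rees P (m + n) (p * q).
Proof.
case: (PP) => _ P0 _ PM [p1 p2] [q1 q2]; split=> j jmn; rewrite coefM.
  apply: (big_ind (P (m + n - j)%N)) => [|f g|[i /= ij] _]; [exact: P0|exact: filtrationD|].
  have [im|mi] := leqP i m; last by rewrite p2 // mul0r.
  have [jin|nji] := leqP (j - i) n; last by rewrite q2 // mulr0.
  have -> : (m + n - j = (m - i) + (n - (j - i)))%N by lia.
  by apply: PM; auto.
rewrite big1 // => -[i /= ij] _.
have [im|mi] := leqP i m; last by rewrite p2 // mul0r.
by rewrite q2 ?mulr0 //; lia.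
Qed.

Lemma rees_prod n (F : 'I_n -> {poly B}) :
  (forall i, rees P 1 (F i)) -> rees P n (\prod_(i < n) F i).
Proof.
elim: n F => [|n IHn] F PF; first by rewrite big_ord0; apply: rees1.
rewrite big_ord_recl; apply: (@reesM 1 n); first exact: PF.
by apply: IHn => i; apply: PF.
Qed.

(** The entries of X - A have degree 1 in the Rees algebra, so the determinant
    has degree n. *)
Lemma rees_char_poly n (A : 'M[B]_n) :
  (forall i j, P 1 (A i j)) -> rees P n (char_poly A).
Proof.
move=> PA; case: (PP) => P1 P0 _ _; rewrite /char_poly /determinant.
apply: big_ind => [|p q|s _]; [exact: rees0|exact: reesD|].
have ent i j : rees P 1 (char_poly_mx A i j).
  rewrite !mxE; apply: reesD; last first.
    apply: reesN; split=> [[|[|k]]|[|k]] //= _; rewrite coefC //=; exact: P0.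
  case: eqP => [_|_]; rewrite ?mulr1n ?mulr0n; last exact: rees0.
  by split=> [[|[|k]]|[|[|k]]] //= _; rewrite coefX.
have prd (f : 'I_n -> 'I_n) : rees P n (\prod_i char_poly_mx A i (f i)).
  by apply: rees_prod => i; apply: ent.
by case: (perm.odd_perm s); rewrite ?expr1 ?mulN1r ?expr0 ?mul1r //; apply: reesN.
Qed.
End Rees.

(** Multiplication by F on the span of the v_k is given by a matrix A with
    entries in P 1, so det (F - A) kills each v_k; as v_k0 is a nonzerodivisor,
    F is a root of the characteristic polynomial of A. *)
Lemma det_trick (P : nat -> set B) (T : finType) (v : T -> B) (k0 : T) (F : B) :
  ring_filtration P ->
  (forall x, x * v k0 = 0 -> x = 0) ->
  (forall k, exists2 a : T -> B, forall l, P 1%N (a l) & F * v k = \sum_l a l * v l) ->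
  exists (n : nat) (a : nat -> B), [/\ (0 < n)%N,
    forall i, (1 <= i <= n)%N -> P i (a i) &
    F ^+ n + \sum_(1 <= i < n.+1) a i * F ^+ (n - i) = 0].
Proof.
move=> PP reg Fv;
have /choice[a aE] : forall k, exists a,
    (forall l, P 1%N (a l)) /\ F * v k = \sum_l a l * v l.
  by move=> k; have [a] := Fv k; exists a.
set n := #|T|.
have n0 : (0 < n)%N by apply/card_gt0P; exists k0.
pose A : 'M[B]_n := \matrix_(i, j) a (enum_val i) (enum_val j).
have [cP _] : rees P n (char_poly A).
  by apply: rees_char_poly => // i j; rewrite mxE; case: (aE (enum_val i)).
pose V : 'cV[B]_n := \col_i v (enum_val i).
have AV : (F%:M - A) *m V = 0.
  rewrite mulmxBl mul_scalar_mx; apply/colP => i; rewrite !mxE (aE _).2.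
  apply/eqP; rewrite subr_eq0; apply/eqP; rewrite (reindex (@enum_val T predT)) /=.
    by apply: eq_bigr => j _; rewrite !mxE.
  exact/onW_bij/(@enum_val_bij T).
have detE : (char_poly A).[F] = \det (F%:M - A).
  rewrite -[LHS]/(horner_eval F (char_poly A)) -det_map_mx; congr (\det _).
  apply/matrixP => i j; rewrite !mxE /= /horner_eval hornerD hornerN hornerC.
  by case: eqP; rewrite ?mulr1n ?mulr0n ?hornerX ?horner0.
have root0 : (char_poly A).[F] = 0.
  apply: reg; rewrite detE.
  have /(congr1 (mulmx (\adj (F%:M - A)))) := AV.
  rewrite mulmxA mul_adj_mx mulmx0 mul_scalar_mx => /colP/(_ (enum_rank k0)).
  by rewrite !mxE enum_rankK.
exists n, (fun i => (char_poly A)`_(n - i)); split=> // [i /andP[i1 iN]|].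
  by rewrite -{1}(subKn iN); apply: cP; rewrite leq_subr.
rewrite -[RHS]root0 horner_coef size_char_poly.
rewrite -(big_mkord xpredT (fun i => (char_poly A)`_i * F ^+ i)).
rewrite [RHS]big_nat_rev /= [RHS]big_ltn // add0n subSS subn0; congr (_ + _).
have := char_poly_monic A; rewrite monicE /lead_coef size_char_poly /= => /eqP ->.
by rewrite mul1r.
Qed.
End DeterminantTrick.

Section IdealProducts.
Variable B : comNzRingType.
Implicit Types (I V : set B).

Definition ideal_mul I V : set B := ideal_gen [set w |
  exists f v, [/\ I f, V v & w = f * v]].

(** For finite V containing a nonzerodivisor this implies that F is integral over
    I.  Unlike the integral equation itself, the condition for a fixed V is
    visibly stable under sums and multiples of F. *)
Definition reduces I V (F : B) : Prop := forall v, V v -> ideal_mul I V (F * v).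

Lemma reduces_mem I V F : I F -> reduces I V F.
Proof. by move=> IF v Vv; apply: ideal_gen_mem; exists F, v. Qed.

Lemma reduces0 I V : reduces I V 0.
Proof. by move=> v Vv; rewrite mul0r; apply: ideal_gen0. Qed.

Lemma reducesD I V F F' : reduces I V F -> reduces I V F' -> reduces I V (F + F').
Proof. by move=> H H' v Vv; rewrite mulrDl; apply: ideal_genD; [exact: H|exact: H']. Qed.

Lemma reducesMl I V c F : reduces I V F -> reduces I V (c * F).
Proof. by move=> H v Vv; rewrite -mulrA; apply/ideal_genMl/H. Qed.

Lemma reduces_sum I V (T : Type) (r : seq T) (P : pred T) (F : T -> B) :
  (forall i, P i -> reduces I V (F i)) -> reduces I V (\sum_(i <- r | P i) F i).
Proof.
move=> IF; elim/big_ind: _ => //; [exact: reduces0|exact: reducesD].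
Qed.

Lemma reduces_prodB I V (T : Type) (r : seq T) (u w : T -> B) :
  (forall i, reduces I V (u i - w i)) ->
  reduces I V (\prod_(i <- r) u i - \prod_(i <- r) w i).
Proof.
move=> H; elim: r => [|i r IH]; first by rewrite !big_nil subrr; apply: reduces0.
rewrite !big_cons.
have -> : u i * \prod_(j <- r) u j - w i * \prod_(j <- r) w j =
  \prod_(j <- r) u j * (u i - w i) +
  w i * (\prod_(j <- r) u j - \prod_(j <- r) w j) by ring.
by apply: reducesD; apply: reducesMl.
Qed.

Lemma reg_prod (T : Type) (r : seq T) (u : T -> B) :
  (forall i z, z * u i = 0 -> z = 0) -> forall z, z * \prod_(i <- r) u i = 0 -> z = 0.
Proof.
move=> H; elim: r => [|i r IH] z; first by rewrite big_nil mulr1.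
by rewrite big_cons mulrA => /IH /H.
Qed.

Lemma reduces_closure (S : set B) (T : finType) (v : T -> B) (k0 : T) F :
  (forall x, x * v k0 = 0 -> x = 0) ->
  reduces (ideal_gen S) (fun w => exists k, w = v k) F ->
  ideal_closure (ideal_gen S) F.
Proof.
move=> reg red; apply: (det_trick (P := ideal_exp (ideal_gen S)) (k0 := k0)) reg _.
- split; [exact: ideal_exp0|by move=> i; apply: ideal_gen0|..|exact: ideal_expM].
  by move=> i f g; apply: ideal_genB.
move=> k; suff [a Ia ->] : exists2 a : T -> B, forall l, ideal_gen S (a l) &
    F * v k = \sum_l a l * v l.
  by exists a => // l; apply: ideal_exp1.
elim/ideal_gen_ind: (red _ (ex_intro _ k erefl)) => [|c w f [g [_ [Ig [l ->] ->]]] [a Ia ->]].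
  exists (fun=> 0) => [l|]; first exact: ideal_gen0.
  by rewrite big1 // => l _; rewrite mul0r.
exists (fun l' => (if l' == l then c * g else 0) + a l') => [l'|].
  apply: ideal_genD => //; case: eqP => _; [exact: ideal_genMl|exact: ideal_gen0].
under [RHS]eq_bigr do rewrite mulrDl.
rewrite big_split /=; congr (_ + _).
rewrite (bigD1 l) //= eqxx mulrA big1 ?addr0 // => l' /negPf ->.
by rewrite mul0r.
Qed.

End IdealProducts.

(** * Saturation of a numerical semigroup *)

(** The condition says that the gcd of the elements of G up to a divides a,
    without singling out that gcd (which is 0 when 0 is the only such element). *)
Definition gcd_saturation (G : set nat) : set nat := fun a =>
  forall n, (forall g, G g -> (g <= a)%N -> (n %| g)%N) -> (n %| a)%N.

Lemma sub_gcd_saturation (G : set nat) a : G a -> gcd_saturation G a.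
Proof. by move=> Ga n; apply. Qed.

Lemma gcd_saturationD (G : set nat) a b :
  gcd_saturation G a -> gcd_saturation G b -> gcd_saturation G (a + b)%N.
Proof.
move=> Ga Gb n nG; apply: dvdn_add; [apply: Ga|apply: Gb] => g Gg ga;
  apply: nG => //; lia.
Qed.

Lemma closed_subn_gcd (T : set nat) : T 0%N ->
  (forall k l, T k -> T l -> T (k + l)%N) ->
  (forall k l, T k -> T l -> T (k - l)%N) ->
  exists2 g, forall t, T t -> (g %| t)%N & forall m, T (m * g)%N.
Proof.
move=> T0 TD TB.
have TM g : T g -> forall m, T (m * g)%N.
  by move=> Tg; elim=> [|m IH]; rewrite ?mul0n // mulSn; apply: TD.
have [[p Tp p0]|Tn] := pselect (exists2 p, T p & (0 < p)%N); last first.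
  exists 0%N => [t Tt|m]; last by rewrite muln0.
  by rewrite dvd0n; apply/negP => /negP; rewrite -lt0n => t0; apply: Tn; exists t.
(* the smallest positive element of T divides all others, by division *)
have ex : exists p, (0 < p)%N && `[< T p >] by exists p; rewrite p0; apply/asboolP.
case: (ex_minnP ex) => g /andP[g0 /asboolP Tg] gmin.
exists g; last exact: TM.
move=> t Tt; rewrite /dvdn; apply/negP => /negP; rewrite -lt0n => r0.
suff : (g <= t %% g)%N by rewrite leqNgt ltn_mod g0.
apply: gmin; rewrite r0; apply/asboolP.
by rewrite -[(t %% g)%N](addKn (t %/ g * g)) -divn_eq; apply: TB => //; apply: TM.
Qed.

(** * Differences of powers *)

Section PowerDifferences.
Variables (B : comNzRingType) (x y : B) (L : set nat).

(** If x and y were variables, this would be generated by the forms of degree N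
    in the ideal of the x^g - y^g.  Recording N bounds the degrees of the
    coefficients of these differences from below. *)
Definition diff_span (N : nat) : set B := ideal_gen [set f |
  exists g i j, [/\ L g, (i + j + g = N)%N & f = x ^+ i * y ^+ j * (x ^+ g - y ^+ g)]].

(** Forms of large degree times x^l - y^l lie in the ideal of the x^g - y^g:
    that is, x^l - y^l is in this ideal away from the origin. *)
Definition absorbed (l : nat) : Prop := exists N0, forall i j, (N0 <= i + j)%N ->
  diff_span (i + j + l) (x ^+ i * y ^+ j * (x ^+ l - y ^+ l)).

Lemma absorbed_mem l : L l -> absorbed l.
Proof. by move=> Ll; exists 0%N => i j _; apply: ideal_gen_mem; exists l, i, j. Qed.

Lemma absorbed0 : absorbed 0.
Proof. by exists 0%N => i j _; rewrite !expr0 subrr mulr0; apply: ideal_gen0. Qed.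

Lemma absorbedD k l : absorbed k -> absorbed l -> absorbed (k + l).
Proof.
move=> [N1 H1] [N2 H2]; exists (N1 + N2)%N => i j ij.
have -> : x ^+ i * y ^+ j * (x ^+ (k + l) - y ^+ (k + l)) =
    x ^+ (i + l) * y ^+ j * (x ^+ k - y ^+ k)
  + x ^+ i * y ^+ (j + k) * (x ^+ l - y ^+ l) by rewrite !exprD; ring.
apply: ideal_genD.
  have -> : (i + j + (k + l) = i + l + j + k)%N by lia.
  by apply: H1; lia.
have -> : (i + j + (k + l) = i + (j + k) + l)%N by lia.
by apply: H2; lia.
Qed.

(** The difference step of Euclid's algorithm: with k = m + l,
    x^l (x^m - y^m) = (x^k - y^k) - y^m (x^l - y^l), and symmetrically with y^l
    on the left.  A monomial of degree at least 2 l is divisible by x^l or y^l. *)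
Lemma absorbedB k l : absorbed k -> absorbed l -> absorbed (k - l).
Proof.
move=> [N1 H1] [N2 H2].
have [lk|/ltnW kl] := leqP l k; last by rewrite (eqP kl); apply: absorbed0.
have [m km] : exists m, (k = m + l)%N by exists (k - l)%N; lia.
move: H1; rewrite km addnK => H1; exists (N1 + N2 + l + l)%N => i j ij.
have [li|il] := leqP l i.
  have -> : (i = (i - l) + l)%N by lia.
  set p := (i - l)%N.
  have -> : x ^+ (p + l) * y ^+ j * (x ^+ m - y ^+ m) =
      x ^+ p * y ^+ j * (x ^+ (m + l) - y ^+ (m + l))
    - x ^+ p * y ^+ (j + m) * (x ^+ l - y ^+ l) by rewrite !exprD; ring.
  apply: ideal_genB.
    have -> : (p + l + j + m = p + j + (m + l))%N by lia.
    by apply: H1; lia.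
  have -> : (p + l + j + m = p + (j + m) + l)%N by lia.
  by apply: H2; lia.
have -> : (j = (j - l) + l)%N by lia.
set p := (j - l)%N.
have -> : x ^+ i * y ^+ (p + l) * (x ^+ m - y ^+ m) =
    x ^+ i * y ^+ p * (x ^+ (m + l) - y ^+ (m + l))
  - x ^+ (i + m) * y ^+ p * (x ^+ l - y ^+ l) by rewrite !exprD; ring.
apply: ideal_genB.
  have -> : (i + (p + l) + m = i + p + (m + l))%N by lia.
  by apply: H1; lia.
have -> : (i + (p + l) + m = i + m + p + l)%N by lia.
by apply: H2; lia.
Qed.

End PowerDifferences.

(** Euclid's algorithm reaches the gcd of the g <= a in G, hence its multiple a.
    The bound g <= a is what turns absorption into integral dependence. *)
Lemma absorbed_gcd_saturation (B : comNzRingType) (x y : B) (G : set nat) a :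
  gcd_saturation G a -> absorbed x y (fun g => G g /\ (g <= a)%N) a.
Proof.
move=> Ga; set L := fun g => _.
have [g dvd mul] :=
  closed_subn_gcd (absorbed0 x y L) (@absorbedD _ x y L) (@absorbedB _ x y L).
have /dvdnP[m ->] : (g %| a)%N.
  by apply: Ga => h Gh ha; apply/dvd/absorbed_mem.
exact: mul.
Qed.

Section MonomialModule.
Variables (B : comNzRingType) (I : set B) (d N : nat) (x y : 'I_d -> B).

Definition pair_powers (i : 'I_d) (k : 'I_N.+1) : B := x i ^+ k * y i ^+ (N - k).

(** Generators of the product of the ideals (x_i, y_i)^N. *)
Definition prod_powers (k : {ffun 'I_d -> 'I_N.+1}) : B :=
  \prod_i pair_powers i (k i).

Lemma reduces_prod (i : 'I_d) F :
  reduces I (fun w => exists k, w = pair_powers i k) F ->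
  reduces I (fun w => exists k, w = prod_powers k) F.
Proof.
move=> red _ [k ->]; rewrite /prod_powers (bigD1 i) //= mulrA.
elim/ideal_gen_ind: (red _ (ex_intro _ (k i) erefl)) => [|c w f [g [_ [Ig [l ->] ->]]] IH].
  by rewrite mul0r; apply: ideal_gen0.
rewrite mulrDl; apply: ideal_genD => //; rewrite -mulrA -[g * _ * _]mulrA.
apply/ideal_genMl/ideal_gen_mem; eexists g, _; split=> //.
exists [ffun j => if j == i then l else k j].
rewrite /prod_powers [RHS](bigD1 i) //= ffunE eqxx; congr (_ * _).
by apply: eq_bigr => j /negPf ji; rewrite ffunE ji.
Qed.

(** Since g <= a, a form of degree N + a in the ideal of the x^g - y^g has
    coefficients of degree at least N, so one can split off a generator of
    (x, y)^N from each of them. *)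
Lemma reduces_power_diff (i : 'I_d) (G : set nat) a :
  (forall g, G g -> I (x i ^+ g - y i ^+ g)) ->
  (forall p q, (N = p + q)%N ->
     diff_span (x i) (y i) (fun g => G g /\ (g <= a)%N) (p + q + a)
       (x i ^+ p * y i ^+ q * (x i ^+ a - y i ^+ a))) ->
  reduces I (fun w => exists k, w = pair_powers i k) (x i ^+ a - y i ^+ a).
Proof.
move=> GI H _ [k ->]; rewrite mulrC /pair_powers.
have kN : (N = k + (N - k))%N by have := ltn_ord k; lia.
elim/ideal_gen_ind: (H _ _ kN) => [|c s f [g [p [q [[Gg ga] E ->]]]] IH].
  exact: ideal_gen0.
apply: ideal_genD => //; apply: ideal_genMl.
have pqN : (N <= p + q)%N by lia.
(* a divisor of degree N of x^p y^q, with p + q >= N *)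
have p'N : (minn p N < N.+1)%N by lia.
have -> : x i ^+ p * y i ^+ q * (x i ^+ g - y i ^+ g) =
   x i ^+ (p - minn p N) * y i ^+ (q - (N - minn p N)) *
   ((x i ^+ g - y i ^+ g) * pair_powers i (Ordinal p'N)).
  rewrite /pair_powers /=.
  have {1}-> : (p = (p - minn p N) + minn p N)%N by lia.
  have {1}-> : (q = (q - (N - minn p N)) + (N - minn p N))%N by lia.
  rewrite !exprD; ring.
apply/ideal_genMl/ideal_gen_mem.
exists (x i ^+ g - y i ^+ g), (pair_powers i (Ordinal p'N)).
by split; [exact: GI|exists (Ordinal p'N)|].
Qed.

End MonomialModule.

(** * Monomial multiples of power series *)

Section MonomialShift.
Variable K : comNzRingType.

Lemma fcoef_sum n (T : Type) (r : seq T) (P : pred T) (F : T -> fps K n) m :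
  fcoef (\sum_(i <- r | P i) F i) m = \sum_(i <- r | P i) fcoef (F i) m.
Proof. by elim/big_rec2: _ => // i _ f _ <-. Qed.

Lemma fcoefXM n (e : 'X_{1..n}) (f : fps K n) m :
  fcoef (fpsX K e * f) m = if (e <= m)%MM then fcoef f (m - e)%MM else 0.
Proof.
have [em|em] := boolP (e <= m)%MM; last first.
  apply: big1 => -[k l] /= /eqP mkl; case: eqP => [ke|_]; last by rewrite mul0r.
  by case/negP: em; rewrite mkl ke lem_addr.
have b1 : (mdeg e < (mdeg m).+1)%N by rewrite ltnS -(submK em) mdegD leq_addl.
have b2 : (mdeg (m - e) < (mdeg m).+1)%N by rewrite ltnS -{2}(submK em) mdegD leq_addr.
rewrite [LHS](bigD1 (BMultinom b1, BMultinom b2)) /=; last by rewrite addmC submK.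
rewrite eqxx mul1r big1 ?addr0 // => -[k l] /= /andP[/eqP mkl].
have [ke|] := (k : 'X_{1..n}) =P e; last by rewrite mul0r.
case/eqP; congr (_, _); apply: val_inj => //=.
by rewrite -ke; apply/esym; rewrite [X in (X - _)%MM]mkl addmC addmK.
Qed.

Lemma mnm_morphX d (h : 'X_{1..d} -> K) :
  h 0%MM = 1 -> (forall a b, h (a + b)%MM = h a * h b) ->
  forall e n, h (e *+ n)%MM = h e ^+ n.
Proof.
by move=> h0 hD e; elim=> [|n IH]; rewrite ?mulm0n ?h0 // mulmS hD IH exprS.
Qed.

Lemma mnm_morph_prod d (h : 'X_{1..d} -> K) :
  h 0%MM = 1 -> (forall a b, h (a + b)%MM = h a * h b) ->
  forall e, h e = \prod_i h U_(i)%MM ^+ e i.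
Proof.
move=> h0 hD e; rewrite {1}[e]multinomUE_id.
under [RHS]eq_bigr do rewrite -(mnm_morphX h0 hD).
exact: (big_morph h hD h0).
Qed.

Lemma fpsXM n (a b : 'X_{1..n}) : fpsX K a * fpsX K b = fpsX K (a + b)%MM.
Proof.
apply: fpsP => m; rewrite fcoefXM /=; have [am|am] := boolP (a <= m)%MM.
  by rewrite -(eqm_add2r a) submK // (addmC b).
by case: eqP => // mab; case/negP: am; rewrite mab lem_addr.
Qed.

Lemma fpsX_reg n (e : 'X_{1..n}) (f : fps K n) : f * fpsX K e = 0 -> f = 0.
Proof.
move=> fe; apply: fpsP => m; have := congr1 (fun g => fcoef g (m + e)%MM) fe.
by rewrite mulrC fcoefXM lem_addl addmK.
Qed.
End MonomialShift.

Lemma fcoefM_neq0 (K : idomainType) d (f g : fps K d) (m : 'X_{1..d}) :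
  fcoef (f * g) m != 0 ->
  exists k l, [/\ m = (k + l)%MM, fcoef f k != 0 & fcoef g l != 0].
Proof.
move=> fg; apply: contrapT => H; case/eqP: fg; apply: big1 => -[k l] /= /eqP mkl.
apply/eqP/negP => /negP; rewrite mulf_eq0 negb_or => /andP[fk gl].
by apply: H; exists k, l.
Qed.

Section CpsMonomials.
Variables (K : numFieldType).

Lemma cpsXM d (a b : 'X_{1..d}) : cpsX K (a + b)%MM = cpsX K a * cpsX K b.
Proof. by apply: val_inj; rewrite rmorphM /= fpsXM. Qed.

Lemma cpsX0 d : cpsX K (0%MM : 'X_{1..d}) = 1.
Proof. exact: val_inj. Qed.

Lemma cpsX_reg d (e : 'X_{1..d}) (f : cps K d) : f * cpsX K e = 0 -> f = 0.
Proof.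
by move=> /(congr1 val); rewrite rmorphM /= => /fpsX_reg fe; apply: val_inj.
Qed.

Lemma cpsXM_coef d (e : 'X_{1..d}) (f : cps K d) m :
  fcoef (cpsX K e * f) m = if (e <= m)%MM then fcoef f (m - e)%MM else 0.
Proof. exact: fcoefXM. Qed.

Lemma fcoef_in_x d (f : cps K d) m :
  fcoef (in_x f) m = if mnm_right m == 0%MM then fcoef f (mnm_left m) else 0.
Proof. by []. Qed.

Lemma fcoef_in_y d (f : cps K d) m :
  fcoef (in_y f) m = if mnm_left m == 0%MM then fcoef f (mnm_right m) else 0.
Proof. by []. Qed.

Lemma in_xD d (f g : cps K d) : in_x (f + g) = in_x f + in_x g.
Proof.
by apply: val_inj; apply: fpsP => m /=; case: eqP => _; rewrite ?addr0.
Qed.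

Lemma in_yD d (f g : cps K d) : in_y (f + g) = in_y f + in_y g.
Proof.
by apply: val_inj; apply: fpsP => m /=; case: eqP => _; rewrite ?addr0.
Qed.

Lemma in_x0 d : in_x (0 : cps K d) = 0.
Proof. by apply: (addrI (in_x 0)); rewrite -in_xD !addr0. Qed.

Lemma in_y0 d : in_y (0 : cps K d) = 0.
Proof. by apply: (addrI (in_y 0)); rewrite -in_yD !addr0. Qed.

Lemma mnm_leftD d (a b : 'X_{1..d + d}) : mnm_left (a + b) = (mnm_left a + mnm_left b)%MM.
Proof. by apply/mnmP => i; rewrite !mnmE. Qed.

Lemma mnm_rightD d (a b : 'X_{1..d + d}) : mnm_right (a + b) = (mnm_right a + mnm_right b)%MM.
Proof. by apply/mnmP => i; rewrite !mnmE. Qed.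

Lemma mnm_pairD d (a b a' b' : 'X_{1..d}) :
  mnm_pair (a + a') (b + b') = (mnm_pair a b + mnm_pair a' b')%MM.
Proof. by rewrite -[RHS]mnm_pairK mnm_leftD mnm_rightD !mnm_pair_left !mnm_pair_right. Qed.

Lemma mnm_pair0 d : mnm_pair (0 : 'X_{1..d}) 0 = 0%MM.
Proof. by apply/mnmP => i; rewrite !mnmE; case: split => j; rewrite mnmE. Qed.

Lemma mnm_pair_lepm d (a b a' b' : 'X_{1..d}) :
  (mnm_pair a b <= mnm_pair a' b')%MM = (a <= a')%MM && (b <= b')%MM.
Proof.
apply/idP/andP => [le|[/submK aa /submK bb]]; last first.
  by rewrite -aa -bb mnm_pairD lem_addl.
split; apply/mnm_lepP => i.
  have /mnm_lepP/(_ (lshift d i)) := le.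
  by rewrite !mnmE (unsplitK (inl i)).
have /mnm_lepP/(_ (rshift d i)) := le.
by rewrite !mnmE (unsplitK (inr i)).
Qed.

Lemma in_xXM d (e : 'X_{1..d}) (f : cps K d) :
  in_x (cpsX K e * f) = cpsX K (mnm_pair e 0) * in_x f.
Proof.
apply: val_inj; apply: fpsP => m.
rewrite cpsXM_coef !fcoef_in_x cpsXM_coef.
have -> : (mnm_pair e 0 <= m)%MM = (e <= mnm_left m)%MM.
  rewrite -[X in (_ <= X)%MM]mnm_pairK mnm_pair_lepm andbC.
  by have /mnm_lepP -> : forall i, (0%MM i <= mnm_right m i)%N by move=> i; rewrite mnm0E.
 have [em|em] := boolP (e <= _)%MM; last by case: ifP.
have mE : m = (mnm_pair (mnm_left m - e) (mnm_right m) + mnm_pair e 0)%MM.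
  by rewrite -mnm_pairD addm0 submK // mnm_pairK.
have -> : (m - mnm_pair e 0)%MM = mnm_pair (mnm_left m - e) (mnm_right m).
  by rewrite [in LHS]mE addmK.
by rewrite mnm_pair_left mnm_pair_right.
Qed.

Lemma in_yXM d (e : 'X_{1..d}) (f : cps K d) :
  in_y (cpsX K e * f) = cpsX K (mnm_pair 0 e) * in_y f.
Proof.
apply: val_inj; apply: fpsP => m.
rewrite cpsXM_coef !fcoef_in_y cpsXM_coef.
have -> : (mnm_pair 0 e <= m)%MM = (e <= mnm_right m)%MM.
  rewrite -[X in (_ <= X)%MM]mnm_pairK mnm_pair_lepm.
  by have /mnm_lepP -> : forall i, (0%MM i <= mnm_left m i)%N by move=> i; rewrite mnm0E.
 have [em|em] := boolP (e <= _)%MM; last by case: ifP.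
have mE : m = (mnm_pair (mnm_left m) (mnm_right m - e) + mnm_pair 0 e)%MM.
  by rewrite -mnm_pairD addm0 submK // mnm_pairK.
have -> : (m - mnm_pair 0 e)%MM = mnm_pair (mnm_left m) (mnm_right m - e).
  by rewrite [in LHS]mE addmK.
by rewrite mnm_pair_left mnm_pair_right.
Qed.

Lemma in_x_cpsX d (e : 'X_{1..d}) : in_x (cpsX K e) = cpsX K (mnm_pair e 0).
Proof.
apply: val_inj; apply: fpsP => m /=; rewrite -[in RHS](mnm_pairK m).
have [/eqP r0|r0] := ifPn; last first.
  case: eqP => // /(congr1 (@mnm_right d)); rewrite !mnm_pair_right => r0'.
  by rewrite r0' eqxx in r0.
rewrite r0; congr (nat_of_bool _)%:R; apply/eqP/eqP => [->//|].
by move=> /(congr1 (@mnm_left d)); rewrite !mnm_pair_left.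
Qed.

Lemma in_y_cpsX d (e : 'X_{1..d}) : in_y (cpsX K e) = cpsX K (mnm_pair 0 e).
Proof.
apply: val_inj; apply: fpsP => m /=; rewrite -[in RHS](mnm_pairK m).
have [/eqP r0|r0] := ifPn; last first.
  case: eqP => // /(congr1 (@mnm_left d)); rewrite !mnm_pair_left => r0'.
  by rewrite r0' eqxx in r0.
rewrite r0; congr (nat_of_bool _)%:R; apply/eqP/eqP => [->//|].
by move=> /(congr1 (@mnm_right d)); rewrite !mnm_pair_right.
Qed.

Lemma in_xX0 d : in_x (cpsX K (0%MM : 'X_{1..d})) = 1.
Proof. by rewrite in_x_cpsX mnm_pair0 cpsX0. Qed.

Lemma in_yX0 d : in_y (cpsX K (0%MM : 'X_{1..d})) = 1.
Proof. by rewrite in_y_cpsX mnm_pair0 cpsX0. Qed.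

Lemma in_xXD d (a b : 'X_{1..d}) :
  in_x (cpsX K (a + b)%MM) = in_x (cpsX K a) * in_x (cpsX K b).
Proof. by rewrite !in_x_cpsX -cpsXM -mnm_pairD addm0. Qed.

Lemma in_yXD d (a b : 'X_{1..d}) :
  in_y (cpsX K (a + b)%MM) = in_y (cpsX K a) * in_y (cpsX K b).
Proof. by rewrite !in_y_cpsX -cpsXM -mnm_pairD addm0. Qed.

End CpsMonomials.

(** * Splitting a convergent series into slices *)

Section Decomposition.
Variables (K : numFieldType) (d N : nat).

(** The exponents at least N are replaced by 0, not by a remainder.  Thus for
    e = low_part m each exponent of m - e is 0 or at least N, hence in every
    numerical semigroup with conductor at most N, and each exponent of e is 0 or
    an exponent of m. *)
Definition low_part (m : 'X_{1..d}) : 'X_{1..d} :=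
  [multinom if (m i < N)%N then m i else 0%N | i < d].

Definition fps_slice (f : cps K d) (e : 'X_{1..d}) : fps K d :=
  FPS (fun k => if low_part (k + e) == e then fcoef f (k + e)%MM else 0).

(** At radius r the slice is dominated by f, divided by r to the degree of e. *)
Lemma fps_slice_convergent f e : fps_slice f e \in @convergentb K d.
Proof.
apply/convergentP; have /convergentP[r [M [r0 H]]] := valP f.
have rX n : 0 <= r ^+ n by rewrite exprn_ge0 // ltW.
exists r, (M / r ^+ mdeg e); split=> // n; rewrite ler_pdivlMr ?exprn_gt0 //.
apply: le_trans (H (n + mdeg e)%N).
have lt (k : 'X_{1..d < n}) : (mdeg (k + e)%MM < n + mdeg e)%N.
  by rewrite mdegD ltn_add2r bmdeg.
pose h (k : 'X_{1..d < n}) := BMultinom (lt k).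
have h_inj : injective h by move=> k l /(congr1 val) /= /addIm /val_inj.
rewrite (bigID (mem (finset.imset h (mem predT)))) /= -[leLHS]addr0.
apply: lerD; last by apply: sumr_ge0 => k _; rewrite mulr_ge0.
rewrite big_imset /=; last by move=> k l _ _; apply: h_inj.
rewrite mulr_suml; apply: ler_sum => k _.
rewrite mdegD exprD mulrA !ler_wpM2r //.
by case: eqP; rewrite // normr0.
Qed.

Definition slice f e : cps K d := CPS (fps_slice_convergent f e).

Definition mnm_of (e : {ffun 'I_d -> 'I_N}) : 'X_{1..d} := [multinom e i : nat | i < d].

Lemma slice_sum f : (0 < N)%N ->
  f = \sum_(e : {ffun 'I_d -> 'I_N}) cpsX K (mnm_of e) * slice f (mnm_of e).
Proof.
move=> N0; apply: val_inj; rewrite raddf_sum /=; apply: fpsP => m.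
rewrite fcoef_sum; under eq_bigr do rewrite fcoefXM.
have lt i : (low_part m i < N)%N by rewrite mnmE; case: ifP.
rewrite (bigD1 [ffun i => Ordinal (lt i)]) //=.
have -> : mnm_of [ffun i => Ordinal (lt i)] = low_part m.
  by apply/mnmP => i; rewrite mnmE ffunE.
have le : (low_part m <= m)%MM by apply/mnm_lepP => i; rewrite mnmE; case: ifP.
rewrite le submK // eqxx big1 ?addr0 // => e ne.
case: ifP => // em; rewrite submK //; case: eqP => // mE.
case/eqP: ne; apply/ffunP => i; apply: val_inj; rewrite ffunE /= mE.
by rewrite mnmE.
Qed.

Lemma sliceP f e k : fcoef (slice f e) k != 0 ->
  [/\ fcoef f (k + e)%MM != 0, forall i, k i = 0%N \/ (N <= k i)%N &
      forall i, e i = (k + e)%MM i \/ e i = 0%N].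
Proof.
rewrite /=; case: ifP => [/eqP ke nz|]; last by rewrite eqxx.
have kei i : (if (k i + e i < N)%N then (k i + e i)%N else 0%N) = e i.
  by rewrite -[RHS](congr1 (fun m : 'X_{1..d} => m i) ke) mnmE mnmDE.
split=> // i; have := kei i; rewrite ?mnmDE; case: ltnP; lia.
Qed.

End Decomposition.

(** * Algebras of products of numerical semigroups *)

Definition box (d : nat) (G : 'I_d -> set nat) : set 'X_{1..d} :=
  fun m => forall i, G i (m i).

Lemma common_conductor d (G : 'I_d -> set nat) :
  (forall i, numerical_semigroup (G i)) ->
  exists2 c, (0 < c)%N & forall i n, (c <= n)%N -> G i n.
Proof.
move=> hG; have /choice[c cG] : forall i, exists c, forall n, (c <= n)%N -> G i n.
  by move=> i; case: (hG i).
exists (\sum_i c i).+1 => // i n cn; apply: cG; apply: leq_trans cn.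
by rewrite (bigD1 i) //= -addnS leq_addr.
Qed.

Section ToricAlgebra.
Variables (K : numFieldType) (d : nat) (S : set 'X_{1..d}).
Hypotheses (S0 : S 0%MM) (SD : forall m n, S m -> S n -> S (m + n)%MM).

Lemma toric_filtration : ring_filtration (fun=> toric_algebra K S).
Proof.
split=> [m|_ m|_ f g Of Og m|_ _ f g Of Og m] /=.
- by case: (m =P 0%MM) => [->|_] // ; rewrite eqxx.
- by rewrite eqxx.
- have [f0|/Of //] := eqVneq (fcoef f m) 0.
  have [g0|/Og //] := eqVneq (fcoef g m) 0.
  by rewrite f0 g0 subr0 eqxx.
by move=> /(@fcoefM_neq0 K d f g m)[k [l [-> /Of Sk /Og Sl]]]; apply: SD.
Qed.

Lemma toric_cpsX m : S m -> toric_algebra K S (cpsX K m).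
Proof. by move=> Sm n /=; case: (n =P m) => [->|_] //; rewrite eqxx. Qed.
End ToricAlgebra.

Section Sufficiency.
Variables (K : numFieldType) (d : nat) (G : 'I_d -> set nat).
Hypothesis hG : forall i, numerical_semigroup (G i).
Local Notation O := (toric_algebra K (box G)).

Lemma box0 : box G 0%MM.
Proof. by move=> i; rewrite mnm0E; case: (hG i). Qed.

Lemma boxD m n : box G m -> box G n -> box G (m + n)%MM.
Proof.
by move=> Sm Sn i; rewrite mnmDE; case: (hG i) => _ GD _; apply: GD.
Qed.

Lemma toric_slice c f e : (forall i n, (c <= n)%N -> G i n) -> O (slice c f e).
Proof.
move=> cG m /sliceP[_ m0 _] i; case: (m0 i) => [->|]; last exact: cG.
by case: (hG i).
Qed.

(** The monomials x^e with all e_i below the conductor generate the convergent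
    series as a module over K{box G}; the monomial with all exponents equal to
    the conductor is a common denominator. *)
Lemma integral_closure_toric f : integral_closure O f.
Proof.
have [c c0 cG] := common_conductor hG; split; last first.
  pose v (e : {ffun 'I_d -> 'I_c}) := cpsX K (mnm_of e).
  apply: (det_trick (P := fun=> O) (v := v) (k0 := [ffun=> Ordinal c0])).
  - exact: toric_filtration box0 boxD.
  - by move=> x; apply: cpsX_reg.
  move=> k; exists (fun l => slice c (f * v k) (mnm_of l)).
    by move=> l; apply: toric_slice.
  rewrite {1}[f * _](slice_sum _ c0); apply: eq_bigr => l _; exact: mulrC.
(* x^e multiplies every series into K{box G} *)
pose e : 'X_{1..d} := [multinom c | _ < d].
exists (cpsX K e * f), (cpsX K e); split=> //.
- move=> m; rewrite cpsXM_coef; case: ifP => [/mnm_lepP em _ i|]; last by rewrite eqxx.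
  by apply: cG; have := em i; rewrite mnmE.
- by apply: toric_cpsX => i; rewrite mnmE; apply: cG.
- apply/eqP => /(congr1 (fun g => fcoef (cps_val g) e)) /=; rewrite eqxx => /eqP.
  by rewrite oner_eq0.
Qed.

Let x (i : 'I_d) : cps K (d + d) := in_x (cpsX K U_(i)%MM).
Let y (i : 'I_d) : cps K (d + d) := in_y (cpsX K U_(i)%MM).

Lemma diagonal_ideal_power i g : G i g -> diagonal_ideal O (x i ^+ g - y i ^+ g).
Proof.
move=> Gg; apply: ideal_gen_mem; exists (cpsX K (U_(i) *+ g)%MM).
  apply: toric_cpsX => j; rewrite mulmnE mnm1E; case: eqP => [<-|_].
    by rewrite mul1n.
  by rewrite mul0n; case: (hG j).
rewrite (mnm_morphX (@in_xX0 K d) (@in_xXD K d)).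
by rewrite (mnm_morphX (@in_yX0 K d) (@in_yXD K d)).
Qed.

(** Writing f as the sum of the x^e f_e, the difference f(x) - f(y) is the sum of
    f_e(x) (x^e - y^e) + y^e (f_e(x) - f_e(y)).  The second term is in the
    diagonal ideal; in the first, x^e - y^e telescopes into multiples of the
    x_i^(e_i) - y_i^(e_i) with e_i in the saturation and below the conductor.
    Only finitely many of these occur, so one N serves for all. *)
Lemma diagonal_closure f : toric_algebra K (box (fun i => gcd_saturation (G i))) f ->
  ideal_closure (diagonal_ideal O) (in_x f - in_y f).
Proof.
move=> Sf; have [c c0 cG] := common_conductor hG.
have /choice[N0 N0P] : forall ia : 'I_d * 'I_c, exists N0, gcd_saturation (G ia.1) ia.2 ->
    forall p q, (N0 <= p + q)%N ->
    diff_span (x ia.1) (y ia.1) (fun g => G ia.1 g /\ (g <= ia.2)%N) (p + q + ia.2)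
       (x ia.1 ^+ p * y ia.1 ^+ q * (x ia.1 ^+ ia.2 - y ia.1 ^+ ia.2)).
  move=> [i a] /=; have [Ga|nGa] := pselect (gcd_saturation (G i) a); last by exists 0%N.
  by have [N0 H] := absorbed_gcd_saturation (x i) (y i) Ga; exists N0.
pose N := (\sum_ia N0 ia)%N.
(* the generator y_1^N ... y_d^N is a monomial, hence a nonzerodivisor *)
pose k0 : {ffun 'I_d -> 'I_N.+1} := [ffun=> ord0].
apply: (reduces_closure (v := prod_powers x y) (k0 := k0)).
  apply: reg_prod => i z; rewrite /pair_powers !ffunE expr0 mul1r.
  rewrite subn0 /y -(mnm_morphX (@in_yX0 K d) (@in_yXD K d)) in_y_cpsX.
  exact: cpsX_reg.
pose V : set (cps K (d + d)) :=
  fun w => exists k : {ffun 'I_d -> 'I_N.+1}, w = prod_powers x y k.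
rewrite -[X in reduces _ X]/V -[X in reduces X]/(diagonal_ideal O).
have redX (i : 'I_d) a : (a < c)%N -> gcd_saturation (G i) a ->
    reduces (diagonal_ideal O) V (x i ^+ a - y i ^+ a).
  move=> ac Ga; apply: (reduces_prod (i := i)).
  apply: (reduces_power_diff (G := G i)); first exact: diagonal_ideal_power.
  move=> p q pq; have := N0P (i, Ordinal ac) Ga p q; apply.
  by rewrite -pq /N (bigD1 (i, Ordinal ac)) //= leq_addr.
have -> : in_x f - in_y f = \sum_(e : {ffun 'I_d -> 'I_c})
    ((in_x (slice c f (mnm_of e)) * (in_x (cpsX K (mnm_of e)) - in_y (cpsX K (mnm_of e)))) +
     (in_y (cpsX K (mnm_of e)) * (in_x (slice c f (mnm_of e)) - in_y (slice c f (mnm_of e))))).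
  rewrite {1 2}[f](slice_sum _ c0).
  rewrite (big_morph _ (@in_xD K d) (in_x0 K d)) (big_morph _ (@in_yD K d) (in_y0 K d)).
  rewrite -sumrB; apply: eq_bigr => e _.
  by rewrite in_xXM in_yXM !in_x_cpsX !in_y_cpsX; ring.
apply: reduces_sum => e _.
have [->|s0] := eqVneq (slice c f (mnm_of e)) 0.
  by rewrite in_x0 in_y0 subrr mulr0 mul0r addr0; apply: reduces0.
apply: reducesD; apply: reducesMl; last first.
  by apply/reduces_mem/ideal_gen_mem; eexists; last reflexivity; apply: toric_slice.
have [m /sliceP[/Sf fm _ em]] : exists m, fcoef (slice c f (mnm_of e)) m != 0.
  apply: contrapT => nm; case/eqP: s0; apply/val_inj/fpsP => m.
  by apply/eqP/negP => fm; apply: nm; exists m; apply/negP.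
rewrite (mnm_morph_prod (@in_xX0 K d) (@in_xXD K d)).
rewrite (mnm_morph_prod (@in_yX0 K d) (@in_yXD K d)); apply: reduces_prodB => i; apply: redX.
  by rewrite mnmE.
by have [->|->] := em i; [exact: fm|move=> n _; exact: dvdn0].
Qed.

End Sufficiency.

(** * Restriction to a twisted diagonal *)

Section TwistedRestriction.
Variables (K : comNzRingType) (d : nat) (z : 'I_d -> K).

Definition twist_subst : (d + d).-tuple {mpoly K[d]} :=
  [tuple match split i with inl j => 'X_j | inr j => z j *: 'X_j end | i < d + d].

(** The factor by which x^m is multiplied under x_i |-> z_i x_i. *)
Definition twist_char (m : 'X_{1..d}) : K := \prod_j z j ^+ m j.

Lemma twist_substX (k : 'X_{1..d + d}) :
  'X_[k] \mPo twist_subst = twist_char (mnm_right k) *: 'X_[mnm_left k + mnm_right k].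
Proof.
rewrite comp_mpolyX big_split_ord /= mpolyXD scalerAr; congr (_ * _).
  rewrite mpolyXE_id; apply: eq_bigr => j _.
  by rewrite tnth_mktuple (unsplitK (inl j)) mnmE.
rewrite mpolyXE_id -scaler_prod; apply: eq_bigr => j _.
by rewrite tnth_mktuple (unsplitK (inr j)) mnmE exprZn.
Qed.

Lemma twist_subst_coef (q : {mpoly K[d + d]}) m : (q \mPo twist_subst)@_m =
  \sum_(k <- msupp q | m == (mnm_left k + mnm_right k)%MM)
     q@_k * twist_char (mnm_right k).
Proof.
rewrite comp_mpolyEX raddf_sum /= [RHS]big_mkcond; apply: eq_bigr => k _.
rewrite twist_substX !mcoeffZ mcoeffX eq_sym.
by case: eqP => _; rewrite ?mulr1 ?mulr0.
Qed.

Lemma mdeg_left_right (k : 'X_{1..d + d}) : mdeg (mnm_left k + mnm_right k) = mdeg k.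
Proof. by rewrite mdegD -mdeg_pair mnm_pairK. Qed.

(** The substitution preserves degrees; this is why it extends from polynomials
    to power series. *)
Lemma twist_subst_local N (q q' : {mpoly K[d + d]}) m : (mdeg m < N)%N ->
  (forall k, (mdeg k < N)%N -> q@_k = q'@_k) ->
  (q \mPo twist_subst)@_m = (q' \mPo twist_subst)@_m.
Proof.
move=> mN qq'; apply/eqP; rewrite -subr_eq0 -mcoeffB -comp_mpolyB twist_subst_coef.
rewrite big1 // => k /eqP mk; rewrite mcoeffB qq' ?subrr ?mul0r //.
by rewrite -mdeg_left_right -mk.
Qed.

(** The series F(x, z x). *)
Definition twist (F : fps K (d + d)) : fps K d :=
  FPS (fun m => (fps_trunc (mdeg m).+1 F \mPo twist_subst)@_m).

Lemma twistE N F m : (mdeg m < N)%N ->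
  fcoef (twist F) m = (fps_trunc N F \mPo twist_subst)@_m.
Proof.
move=> mN; apply: (@twist_subst_local (mdeg m).+1) => // k km.
by rewrite !fps_truncE // (leq_trans km).
Qed.

Lemma twistB : {morph twist : F H / F - H}.
Proof.
move=> F H; apply: fpsP => m; rewrite /= -mcoeffB -comp_mpolyB.
apply: (@twist_subst_local (mdeg m).+1) => // k km.
by rewrite mcoeffB !fps_truncE.
Qed.

Lemma twist1 : twist 1 = 1.
Proof.
apply: fpsP => m /=; rewrite (@twist_subst_local (mdeg m).+1 _ 1) //.
  by rewrite comp_mpoly1 mcoeff1.
by move=> k km; rewrite fps_truncE //= mcoeff1.
Qed.

(** Up to a given degree, products of series are products of truncations, and
    on polynomials the substitution is a ring morphism. *)
Lemma twistM : {morph twist : F H / F * H}.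
Proof.
move=> F H; apply: fpsP => m; set N := (mdeg m).+1.
have mN : (mdeg m < N)%N by [].
rewrite (fps_mul_trunc _ _ mN) (twistE _ mN).
rewrite (@twist_subst_local N _ (fps_trunc N F * fps_trunc N H)) //.
  rewrite rmorphM /=; apply: (mcoeffM_eq mN) => k kN; rewrite fps_truncE //;
  by rewrite (twistE _ kN).
by move=> k kN; rewrite fps_truncE // (fps_mul_trunc _ _ kN).
Qed.

HB.instance Definition _ := GRing.isZmodMorphism.Build _ _ twist twistB.
HB.instance Definition _ := GRing.isMonoidMorphism.Build _ _ twist (twist1, twistM).

Lemma fcoef_twist F m : fcoef (twist F) m =
  \sum_(k : bmultinom (d + d) (mdeg m).+1 | m == (mnm_left k + mnm_right k)%MM)
     fcoef F k * twist_char (mnm_right k).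
Proof.
rewrite /= /fps_trunc (raddf_sum (comp_mpoly twist_subst)) raddf_sum /= [RHS]big_mkcond.
apply: eq_bigr => k _; rewrite comp_mpolyZ twist_substX !mcoeffZ mcoeffX eq_sym.
by case: eqP => _; rewrite ?mulr1 ?mulr0.
Qed.

End TwistedRestriction.

Section TwistInclusions.
Variables (K : numFieldType) (d : nat) (z : 'I_d -> K).

Lemma twist_in_x (h : cps K d) : twist z (in_x h) = h.
Proof.
apply: fpsP => m; rewrite fcoef_twist.
have lt : (mdeg (mnm_pair m 0) < (mdeg m).+1)%N by rewrite mdeg_pair mdeg0 addn0.
rewrite (bigD1 (BMultinom lt)) /=; last by rewrite mnm_pair_left mnm_pair_right addm0.
rewrite mnm_pair_right eqxx mnm_pair_left /twist_char big1 ?mulr1; last first.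
  by move=> j _; rewrite mnm0E.
rewrite big1 ?addr0 // => k /andP[/eqP mk]; case: ifP => [/eqP r0|]; last by rewrite mul0r.
have lk : mnm_left k = m by rewrite [RHS]mk r0 addm0.
by case/eqP; apply: val_inj => /=; rewrite -[LHS]mnm_pairK r0 lk.
Qed.

Lemma twist_in_y (h : cps K d) m :
  fcoef (twist z (in_y h)) m = twist_char z m * fcoef h m.
Proof.
rewrite fcoef_twist.
have lt : (mdeg (mnm_pair 0 m) < (mdeg m).+1)%N by rewrite mdeg_pair mdeg0 add0n.
rewrite (bigD1 (BMultinom lt)) /=; last by rewrite mnm_pair_left mnm_pair_right add0m.
rewrite mnm_pair_left eqxx mnm_pair_right mulrC.
rewrite big1 ?addr0 // => k /andP[/eqP mk]; case: ifP => [/eqP r0|]; last by rewrite mul0r.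
have rk : mnm_right k = m by rewrite [RHS]mk r0 add0m.
by case/eqP; apply: val_inj => /=; rewrite -[LHS]mnm_pairK r0 rk.
Qed.

End TwistInclusions.

(** * The order in one variable and integral equations *)

Section Order.
Variables (K : idomainType) (d : nat) (i0 : 'I_d).
Implicit Types (f g : fps K d) (m mu nu : 'X_{1..d}).

Definition order_ge (b : nat) : set (fps K d) :=
  fun f => forall m, fcoef f m != 0 -> (b <= m i0)%N.

Lemma order_ge0 b : order_ge b 0.
Proof. by move=> m /=; rewrite eqxx. Qed.

Lemma order_geD b f g : order_ge b f -> order_ge b g -> order_ge b (f + g).
Proof.
move=> of_ og m fg; have [f0|/of_ //] := eqVneq (fcoef f m) 0.
by apply: og; move: fg; rewrite /= f0 add0r.
Qed.

Lemma order_geM b c f g : order_ge b f -> order_ge c g -> order_ge (b + c) (f * g).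
Proof.
move=> of_ og m /fcoefM_neq0[k [l [-> /of_ fk /og gl]]].
by rewrite mnmDE leq_add.
Qed.

Lemma order_ge_any f : order_ge 0 f.
Proof. by []. Qed.

Lemma order_ge_exp b f n : order_ge b f -> order_ge (n * b) (f ^+ n).
Proof.
move=> of_; elim: n => [|n IH]; first exact: order_ge_any.
by rewrite exprS mulSn; apply: order_geM.
Qed.

(** mu is minimal in the support of f for the lexicographic comparison of the
    i0-th exponent followed by the monomial order.  The tie-break makes the
    minimal coefficient multiplicative. *)
Definition lowest mu f := forall m, fcoef f m != 0 ->
  (mu i0 < m i0)%N \/ mu i0 = m i0 /\ (mu <= m)%O.

Lemma lowestM mu nu f g : lowest mu f -> lowest nu g ->
  lowest (mu + nu)%MM (f * g) /\
  fcoef (f * g) (mu + nu)%MM = fcoef f mu * fcoef g nu.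
Proof.
move=> lf lg; split.
  move=> m /fcoefM_neq0[k [l [-> /lf fk /lg gl]]]; rewrite !mnmDE.
  case: fk gl => [lt|[eq le]] [lt'|[eq' le']]; [left; lia|left; lia|left; lia|right].
  by rewrite eq eq'; split=> //; apply: lem_add.
have b1 : (mdeg mu < (mdeg (mu + nu)).+1)%N by rewrite ltnS mdegD leq_addr.
have b2 : (mdeg nu < (mdeg (mu + nu)).+1)%N by rewrite ltnS mdegD leq_addl.
rewrite [LHS](bigD1 (BMultinom b1, BMultinom b2)) //= big1 ?addr0 //.
move=> -[k l] /= /andP[/eqP mkl ne].
have [f0|/lf fk] := eqVneq (fcoef f k) 0; first by rewrite f0 mul0r.
have [g0|/lg gl] := eqVneq (fcoef g l) 0; first by rewrite g0 mulr0.
have mkl0 := congr1 (fun m : 'X_{1..d} => m i0) mkl; rewrite /= !mnmDE in mkl0.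
have [le le'] : (mu <= bmnm k)%O /\ (nu <= bmnm l)%O.
  by case: fk => [lt|[eq le]]; case: gl => [lt'|[eq' le']]; try (exfalso; lia); split.
have kmu : bmnm k = mu.
  move: le; rewrite le_eqVlt => /orP[/eqP //|lt].
  by have := ltmc_le_add lt le'; rewrite -mkl ltxx.
case/eqP: ne; congr (_, _); apply: val_inj => //=.
by move: mkl; rewrite kmu => /addmI.
Qed.

Lemma lowestX mu f n : lowest mu f ->
  lowest (mu *+ n)%MM (f ^+ n) /\ fcoef (f ^+ n) (mu *+ n)%MM = fcoef f mu ^+ n.
Proof.
move=> lf; elim: n => [|n [IH1 IH2]].
  rewrite mulm0n !expr0 /= eqxx; split=> // m /=.
  by case: (m =P 0%MM) => [-> _|_]; [right|rewrite eqxx].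
rewrite mulmS !exprS; have [l1 ->] := lowestM lf IH1.
by rewrite IH2.
Qed.

Lemma lowest_exists b f : ~ order_ge b f ->
  exists mu, [/\ lowest mu f, fcoef f mu != 0 & (mu i0 < b)%N].
Proof.
move=> nb; have ex : exists q, `[< exists2 m, fcoef f m != 0 & m i0 = q >].
  apply: contrapT => H; apply: nb => m fm; case: H; exists (m i0).
  by apply/asboolP; exists m.
case: (ex_minnP ex) => q /asboolP[m0 fm0 m0q] qmin.
have {}qmin m : fcoef f m != 0 -> (q <= m i0)%N.
  by move=> fm; apply: qmin; apply/asboolP; exists m.
have qb : (q < b)%N.
  by rewrite ltnNge; apply/negP => bq; apply: nb => m /qmin; apply: leq_trans.
elim/(@ltmwf d): m0 fm0 m0q => m0 IH fm0 m0q.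
have [[m1 [lt fm1 m1q]]|H] :=
  pselect (exists m1, [/\ (m1 < m0)%O, fcoef f m1 != 0 & m1 i0 = q]).
  exact: IH lt fm1 m1q.
exists m0; split=> //; last by rewrite m0q.
move=> m fm; have := qmin m fm; rewrite leq_eqVlt m0q => /orP[/eqP qm|]; last by left.
right; split=> //; rewrite leNgt; apply/negP => lt; apply: H; exists m; split=> //.
Qed.

(** Order in the i0-th variable is a valuation.  If f had order q < b, then at n
    times its lowest monomial the coefficient of f^n would be nonzero, while
    a_i f^(n - i) has order at least i b + (n - i) q > n q. *)
Lemma order_ge_integral b f n (a : nat -> fps K d) :
  (forall i, (1 <= i <= n)%N -> order_ge (i * b) (a i)) ->
  f ^+ n + \sum_(1 <= i < n.+1) a i * f ^+ (n - i) = 0 -> order_ge b f.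
Proof.
move=> oa eq0; apply: contrapT => /lowest_exists[mu [lf fmu mub]].
have [_ cE] := lowestX n lf.
have := congr1 (fun h => fcoef h (mu *+ n)%MM) eq0; rewrite /= cE fcoef_sum.
rewrite big_nat_cond big1 ?addr0; first by move/eqP; rewrite expf_eq0 (negPf fmu) andbF.
move=> i /andP[/andP[i1 iN] _]; apply/eqP/negP => /negP nz.
have fq : order_ge (mu i0) f by move=> m /lf [/ltnW|[->]].
have ir : (1 <= i <= n)%N by rewrite i1.
have := order_geM (oa i ir) (order_ge_exp fq) nz.
have : (i * mu i0 < i * b)%N by rewrite ltn_mul2l i1.
by rewrite mulmnE mulnBl (mulnC (mu i0)); have := leq_mul2r (mu i0) i n; lia.
Qed.

End Order.

(** A primitive n-th root of unity; it exists because X^n - 1 is separable in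
    characteristic zero. *)
Lemma root_of_unity_neq1 (K : numClosedFieldType) n a : (0 < n)%N -> ~~ (n %| a)%N ->
  exists2 w : K, w ^+ n = 1 & w ^+ a != 1.
Proof.
move=> n0 na; pose p : {poly K} := 'X^n - 1.
have [r Dp] := closed_field_poly_normal p.
rewrite (monicP _) ?monicXnsubC // scale1r in Dp.
have rn1 : all n.-unity_root r by apply/allP=> w; rewrite -root_prod_XsubC -Dp.
have sz_r : (n < (size r).+1)%N by rewrite -(size_prod_XsubC r id) -Dp size_XnsubC.
have ur : uniq r.
  by rewrite -separable_prod_XsubC -Dp separable_Xn_sub_1 // pnatr_eq0 -lt0n.
have /hasP[w _ prim_w] := has_prim_root n0 rn1 ur sz_r.
by exists w; [exact: prim_expr_order|rewrite -(prim_order_dvd prim_w)].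
Qed.

(** * The exponents of the saturation *)

Section Necessity.
Variables (K : numClosedFieldType) (d : nat) (G : 'I_d -> set nat).
Local Notation O := (toric_algebra K (box G)).

(** An exponent outside the saturation would be detected by the restriction to
    y_i0 = w x_i0, for a suitable root of unity w. *)
Lemma closure_exponents f : ideal_closure (diagonal_ideal O) (in_x f - in_y f) ->
  toric_algebra K (box (fun i => gcd_saturation (G i))) f.
Proof.
move=> [n [a [n0 aI eq0]]] m fm i0; apply: contrapT.
move=> /existsNP[p /not_implyP[pG pm]].
have [q [q0 qG qm]] : exists q, [/\ (0 < q)%N,
    forall g, G i0 g -> (g <= m i0)%N -> (q %| g)%N & ~~ (q %| m i0)%N].
  have [p0|p0] := posnP p; last by exists p; split=> //; apply/negP.
  (* 0 is then the only element of G i0 up to m i0, and any q > m i0 will do *)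
  have m0 : (0 < m i0)%N by rewrite lt0n -dvd0n -p0; apply/negP.
  exists (m i0).+1; split=> // [g Gg gm|]; last by rewrite gtnNdvd.
  by have := pG g Gg gm; rewrite p0 dvd0n => /eqP ->.
have [w wq wm] := root_of_unity_neq1 K q0 qm.
pose z (i : 'I_d) := if i == i0 then w else 1.
have charE k : twist_char z k = w ^+ k i0.
  rewrite /twist_char (bigD1 i0) //= /z eqxx big1 ?mulr1 // => i /negPf ->.
  exact: expr1n.
pose psi : {rmorphism cps K (d + d) -> fps K d} := twist z \o val.
have psiE h k : fcoef (psi (in_x h - in_y h)) k = (1 - w ^+ k i0) * fcoef h k.
  by rewrite rmorphB mulrBl mul1r -charE -twist_in_y -(twist_in_x z h).
pose V b := order_ge (K := K) i0 b.
have psiI F : diagonal_ideal O F -> V (m i0).+1 (psi F).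
  elim/ideal_gen_ind => [|c _ F' [h Oh ->] IH]; first by rewrite rmorph0; apply: order_ge0.
  rewrite rmorphD rmorphM; apply: order_geD => //.
  rewrite -[(m i0).+1]add0n; apply: order_geM => //.
  move=> k; rewrite psiE mulf_eq0 negb_or => /andP[wk /Oh/(_ i0) Gk].
  rewrite ltnNge; apply/negP => km; have /dvdnP[t kt] := qG _ Gk km.
  by move: wk; rewrite kt mulnC exprM wq expr1n subrr eqxx.
have psiIn i F : ideal_exp (diagonal_ideal O) i F -> V (i * (m i0).+1)%N (psi F).
  elim/ideal_gen_ind => [|c _ F' [s [Is ->]] IH]; first by rewrite rmorph0; apply: order_ge0.
  rewrite rmorphD rmorphM; apply: order_geD => //.
  rewrite -[(i * _)%N]add0n; apply: order_geM => //.
  elim: i s Is {IH} => [|i IH] s Is; first by [].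
  rewrite big_ord_recl rmorphM mulSn; apply: order_geM; first exact/psiI.
  by apply: IH => j.
have key (F : cps K (d + d)) :
    F ^+ n + \sum_(1 <= i < n.+1) a i * F ^+ (n - i) = 0 -> V (m i0).+1 (psi F).
  move=> F0; apply: (order_ge_integral (n := n) (a := fun i => psi (a i))).
    by move=> i /aI; apply: psiIn.
  rewrite -[RHS](rmorph0 psi) -F0 rmorphD rmorphXn; congr (_ + _).
  by rewrite rmorph_sum; apply: eq_bigr => i _; rewrite rmorphM rmorphXn.
have := key _ eq0 m; rewrite psiE ltnn => H; suff : false by [].
by apply: H; rewrite mulf_neq0 // subr_eq0 eq_sym.
Qed.

End Necessity.

Lemma lipschitz_saturation_toric (K : numClosedFieldType) d (G : 'I_d -> set nat) :
  (forall i, numerical_semigroup (G i)) ->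
  lipschitz_saturation (toric_algebra K (box G)) =
  toric_algebra K (box (fun i => gcd_saturation (G i))).
Proof.
move=> hG; apply/seteqP; split=> f.
  by move=> [_]; apply: closure_exponents.
move=> Sf; split; [exact: integral_closure_toric|exact: diagonal_closure].
Qed.

(** * Generators of products of numerical semigroups *)

Lemma numerical_semigroup_gcd_saturation G :
  numerical_semigroup G -> numerical_semigroup (gcd_saturation G).
Proof.
move=> [G0 GD [c cG]]; split; [exact: sub_gcd_saturation|exact: gcd_saturationD|].
by exists c => n /cG; apply: sub_gcd_saturation.
Qed.

(** Elements outside G are replaced by 0, which is a harmless generator, so that
    generators can be indexed by all a below a bound. *)
Definition gen_exp (G : set nat) (a : nat) : nat := if `[< G a >] then a else 0%N.

(** An element m >= 2 c is a multiple of c plus c + m %% c, which lies in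
    [c, 2 c) and hence in G. *)
Lemma numerical_semigroup_gen G c m : (0 < c)%N -> (forall n, (c <= n)%N -> G n) ->
  G m -> exists k : 'I_(c + c) -> nat, m = (\sum_a k a * gen_exp G a)%N.
Proof.
move=> c0 cG Gm; have [mc|cm] := ltnP m (c + c).
  exists (fun a => a == Ordinal mc); rewrite (bigD1 (Ordinal mc)) //= eqxx.
  rewrite mul1n /gen_exp asboolT // big1 ?addn0 // => a /negPf ->.
  by rewrite mul0n.
have cc : (c < c + c)%N by lia.
have rc : (c + m %% c < c + c)%N by rewrite ltn_add2l ltn_mod.
exists (fun a => (m %/ c).-1 * (a == Ordinal cc) + (a == Ordinal rc))%N.
under eq_bigr do rewrite mulnDl.
rewrite big_split /= (bigD1 (Ordinal cc)) //= eqxx big1 ?addn0; last first.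
  by move=> a /negPf ->; rewrite muln0 mul0n.
rewrite (bigD1 (Ordinal rc)) //= eqxx big1 ?addn0; last first.
  by move=> a /negPf ->; rewrite mul0n.
rewrite muln1 mul1n /gen_exp !asboolT; [|by apply: cG; lia..].
have : (0 < m %/ c)%N by rewrite divn_gt0 //; lia.
by have := divn_eq m c; case: (m %/ c)%N => // q /=; lia.
Qed.

Lemma sum_enum_pair (R : Type) (idx : R) (op : Monoid.com_law idx) (I J : finType)
    (F : I * J -> R) :
  \big[op/idx]_(i < #|{: I * J}|) F (enum_val i) =
  \big[op/idx]_i \big[op/idx]_j F (i, j).
Proof.
rewrite -(big_enum_val (A := predT) F) pair_bigA /=.
by apply: eq_big => // -[].
Qed.

(** The multiples a U_j with a in G j and a < 2 c are generators: every element
    of G j is a sum of elements of G j below 2 c. *)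
Lemma toric_semigroup_box d (G : 'I_d -> set nat) :
  (forall i, numerical_semigroup (G i)) -> toric_semigroup (box G).
Proof.
move=> hG; have [c' c'0 c'G] := common_conductor hG; pose c := c'.+1.
(* c is at least 2, so that c and c + 1 are both below 2 c *)
have c0 : (0 < c)%N by [].
have cG i n : (c <= n)%N -> G i n by move=> cn; apply: c'G; apply: ltnW.
pose T : finType := ('I_d * 'I_(c + c))%type.
pose g (t : T) : 'X_{1..d} := (U_(t.1) *+ gen_exp (G t.1) t.2)%MM.
have gE j a i : g (j, a) i = ((j == i) * gen_exp (G j) a)%N.
  by rewrite mulmnE mnm1E.
exists #|T|, (fun i => g (enum_val i)); split.
  move=> m; split=> [Gm|[k kE] j]; last first.
    have [G0 GD _] := hG j; rewrite kE; apply: big_ind => // i _.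
    case: (enum_val i) => j' a; rewrite gE; case: eqP => [->|_]; last by rewrite muln0.
    rewrite mul1n /gen_exp; case: asboolP => [Ga|_]; last by rewrite muln0.
    by elim: (k i) => [|n IH]; rewrite ?mul0n // mulSn; apply: GD.
  have /choice[k kE] : forall j, exists k : 'I_(c + c) -> nat,
      m j = (\sum_a k a * gen_exp (G j) a)%N.
    by move=> j; apply: numerical_semigroup_gen (Gm j) => //; apply: cG.
  exists (fun i => let t := enum_val i in k t.1 t.2) => j.
  rewrite (sum_enum_pair _ (fun t : T => k t.1 t.2 * g t j)%N) (bigD1 j) //=.
  rewrite [X in (_ + X)%N]big1 ?addn0.
    by rewrite kE; apply: eq_bigr => a _; rewrite gE eqxx mul1n.
  move=> j' /negPf j'j; apply: big1 => a _.
  by rewrite gE j'j mul0n muln0.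
(* c and c + 1 lie in each semigroup, so every z_j is z_j (c + 1) - z_j c *)
move=> z; have lt0 : (c < c + c)%N by lia.
have lt1 : (c.+1 < c + c)%N by lia.
pose k (t : T) : int := z t.1 * ((t.2 == Ordinal lt1)%:R - (t.2 == Ordinal lt0)%:R).
exists (fun i => k (enum_val i)) => j.
rewrite (sum_enum_pair _ (fun t => k t * (g t j)%:Z)) (bigD1 j) //= [X in _ + X]big1 ?addr0.
  under eq_bigr do rewrite gE eqxx mul1n /k /= -mulrA mulrBl mulrBr.
  have pick (o : 'I_(c + c)) : \sum_a z j * ((a == o)%:R * (gen_exp (G j) a)%:Z) =
      z j * (gen_exp (G j) o)%:Z.
    rewrite (bigD1 o) //= eqxx mul1r big1 ?addr0 // => a /negPf ->.
    by rewrite mul0r mulr0.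
  rewrite sumrB !pick /gen_exp !asboolT; [|exact: cG|exact/cG/leqnSn].
  by rewrite -mulrBr intS addrK mulr1.
move=> j' /negPf j'j; apply: big1 => a _.
by rewrite gE j'j mul0n mulr0.
Qed.

(** * Conclusion *)

Lemma exponents_toric (K : numFieldType) d (S : set 'X_{1..d}) :
  exponents (toric_algebra K S) = S.
Proof.
apply/seteqP; split=> m /=; last exact: toric_cpsX.
by apply; rewrite /= eqxx oner_eq0.
Qed.

Lemma toric_singularity_box (K : numFieldType) d (G : 'I_d -> set nat) :
  (forall i, numerical_semigroup (G i)) ->
  toric_singularity (toric_algebra K (box G)) (box G).
Proof.
move=> hG; split; first exact: toric_semigroup_box.
by exists id; split=> //; split=> // h Oh; exists h.
Qed.

Lemma nat_exponents_box G : nat_exponents G = box (fun _ : 'I_1 => G).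
Proof.
by apply/seteqP; split=> m Gm; [move=> i; rewrite (ord1 i)|exact: Gm].
Qed.

Lemma semigroup_prod_box G1 G2 :
  semigroup_prod G1 G2 = box (fun i : 'I_2 => if i == ord0 then G1 else G2).
Proof.
apply/seteqP; split=> m.
  move=> [G1m G2m] i; case: eqP => [->//|/eqP i0].
  by have -> : i = ord_max by apply: val_inj; case: i i0 => -[|[|]].
by move=> Gm; split; [have := Gm ord0|have := Gm ord_max].
Qed.

Lemma exponents_saturation_curve (K : numClosedFieldType) G : numerical_semigroup G ->
  exponents_nat (exponents (lipschitz_saturation (toric_algebra K (nat_exponents G))))
  = gcd_saturation G.
Proof.
move=> hG; rewrite nat_exponents_box lipschitz_saturation_toric // exponents_toric.
apply/seteqP; split=> a; first by move/(_ ord0); rewrite mnmE.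
by move=> Ga i; rewrite mnmE.
Qed.

Theorem proposition4p1 (R : realType) (Gamma1 Gamma2 : set nat)
    (hGamma1 : numerical_semigroup Gamma1)
    (hGamma2 : numerical_semigroup Gamma2) :
  let O1 := toric_algebra R[i] (nat_exponents Gamma1) in
  let O2 := toric_algebra R[i] (nat_exponents Gamma2) in
  let O := toric_algebra R[i] (semigroup_prod Gamma1 Gamma2) in
  let Gamma1s := exponents_nat (exponents (lipschitz_saturation O1)) in
  let Gamma2s := exponents_nat (exponents (lipschitz_saturation O2)) in
  let Gammas := exponents (lipschitz_saturation O) in
  toric_singularity (lipschitz_saturation O) Gammas /\
  Gammas = semigroup_prod Gamma1s Gamma2s.
Proof.
move=> O1 O2 O Gamma1s Gamma2s Gammas.
have hG (i : 'I_2) : numerical_semigroup (if i == ord0 then Gamma1 else Gamma2).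
  by case: ifP.
have OE : lipschitz_saturation O = toric_algebra R[i]
    (box (fun i : 'I_2 => gcd_saturation (if i == ord0 then Gamma1 else Gamma2))).
  by rewrite /O semigroup_prod_box lipschitz_saturation_toric.
have GE : Gammas =
    box (fun i : 'I_2 => gcd_saturation (if i == ord0 then Gamma1 else Gamma2)).
  by rewrite /Gammas OE exponents_toric.
split.
  rewrite GE OE; apply: toric_singularity_box => i.
  exact/numerical_semigroup_gcd_saturation.
rewrite GE /Gamma1s /Gamma2s /O1 /O2.
rewrite (exponents_saturation_curve R[i] hGamma1).
rewrite (exponents_saturation_curve R[i] hGamma2).
rewrite semigroup_prod_box; congr box; apply/funext => i.
by case: ifP.
Qed.
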